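(* Let $n\in\mathbb{Z}$. For any $n$-graded double Gerstenhaber bracket $\{\!\!\{-,-\}\!\!\}$ in a graded algebra $A$ and any cyclic bilinear form $v$ on a coalgebra $M$, the $n$-graded biderivation $\{-,-\}_v$ in the representation algebra $A_M$ is an $n$-graded Gerstenhaber bracket.
   Context: All modules, (co)algebras and tensor products are over a fixed commutative ring $\mathbb{K}$. Algebras are associative, not necessarily unital; coalgebras are coassociative, not necessarily counital, and not graded. Graded means $\mathbb{Z}$-graded, $|a|$ is the degree of a homogeneous element $a$, and $|a|_n=|a|+n$. For a coalgebra $M$, iterated comultiplication with values in $M^{\otimes m}$ is written $\alpha\mapsto\alpha^1\otimes\cdots\otimes\alpha^m$ (summation suppressed). Elements of $A\otimes A$ are written $x=x'\otimes x''$ (summation suppressed, homogeneous factors). Representation algebra: $A_M$ is the graded algebra generated by symbols $a_\alpha$ ($a\in A$, $\alpha\in M$), with $|a_\alpha|=|a|$ for homogeneous $a$, subject to bilinearity of $a_\alpha$ in $(a,\alpha)$, $(ab)_\alpha=a_{\alpha^1}b_{\alpha^2}$, and $a_\alpha b_\beta=(-1)^{|a||b|}b_\beta a_\alpha$ for homogeneous $a,b$. Biderivations and Gerstenhaber brackets: an $n$-graded biderivation in a graded algebra $B$ is a linear map $\{-,-\}:B\otimes B\to B$ with $\{B^p,B^q\}\subset B^{p+q+n}$ and, for homogeneous $a,b,c$, $\{a,bc\}=\{a,b\}c+(-1)^{|a|_n|b|}b\{a,c\}$, $\{ab,c\}=a\{b,c\}+(-1)^{|b||c|_n}\{a,c\}b$,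 $\{a,b\}=-(-1)^{|a|_n|b|_n}\{b,a\}$. Its Jacobi form is $\{a,b,c\}=(-1)^{|a|_n|c|_n}\{a,\{b,c\}\}+(-1)^{|b|_n|a|_n}\{b,\{c,a\}\}+(-1)^{|c|_n|b|_n}\{c,\{a,b\}\}$. The biderivation is an $n$-graded Gerstenhaber bracket if its Jacobi form is zero. Double brackets: for a permutation $(i_1,\dots,i_m)$ of $(1,\dots,m)$, $P_{i_1\cdots i_m,n}:A^{\otimes m}\to A^{\otimes m}$ carries $a_1\otimes\cdots\otimes a_m$ (homogeneous) to $(-1)^t a_{i_1}\otimes\cdots\otimes a_{i_m}$, where $t$ is the sum of $|a_{i_k}|_n|a_{i_l}|_n$ over all $k<l$ with $i_k>i_l$; $P_{i_1\cdots i_m}=P_{i_1\cdots i_m,0}$. Put $a(x\otimes y)b=ax\otimes yb$ and $a*(x\otimes y)*b=(-1)^{|a||xb|+|b||y|}xb\otimes ay$. An $n$-graded double bracket in $A$ is a linear endomorphism $\{\!\!\{-,-\}\!\!\}$ of $A^{\otimes2}$ such that $\{\!\!\{A^p,A^q\}\!\!\}\subset\bigoplus_{i+j=p+q+n}A^i\otimes A^j$; $\{\!\!\{-,-\}\!\!\}P_{21,n}=-P_{21}\{\!\!\{-,-\}\!\!\}$; and for homogeneous $a,b,c$, $\{\!\!\{a,bc\}\!\!\}=\{\!\!\{a,b\}\!\!\}c+(-1)^{|a|_n|b|}b\{\!\!\{a,c\}\!\!\}$ and $\{\!\!\{ab,c\}\!\!\}=a*\{\!\!\{b,c\}\!\!\}+(-1)^{|b||c|_n}\{\!\!\{a,c\}\!\!\}*b$.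 It is an $n$-graded double Gerstenhaber bracket if the induced tribracket $\sum_{i=0}^2P_{312}^i(\{\!\!\{-,-\}\!\!\}\otimes\mathrm{id}_A)(\mathrm{id}_A\otimes\{\!\!\{-,-\}\!\!\})P_{312,n}^{-i}$ on $A^{\otimes3}$ is zero. Cyclic forms: a bilinear form $v:M\otimes M\to\mathbb{K}$ is cyclic if $\widehat v:M\otimes M\to M\otimes M$, $\widehat v(\alpha\otimes\beta)=v(\alpha\otimes\beta^2)\beta^1\otimes\beta^3$, commutes with the flip of the factors. The biderivation $\{-,-\}_v$: given an $n$-graded double bracket in $A$ and a cyclic form $v$ on $M$, $\{-,-\}_v$ denotes the unique $n$-graded biderivation in $A_M$ such that $\{a_\alpha,b_\beta\}_v=v(\alpha\otimes\beta^2)\,\{\!\!\{a,b\}\!\!\}'_{\beta^1}\{\!\!\{a,b\}\!\!\}''_{\beta^3}$ for all $a,b\in A$, $\alpha,\beta\in M$. *)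

(* Defs.v *)
From HB Require Import structures.
From mathcomp Require Import all_boot all_order all_algebra.
From mathcomp Require Import boolp.

Set Implicit Arguments.
Unset Strict Implicit.
Unset Printing Implicit Defensive.

Import GRing.Theory.
Local Open Scope ring_scope.
Local Open Scope quotient_scope.

(* The predicate is spelled out because the bilinear maps of sesquilinear.v
   require a nonzero ground ring. *)
Definition bilin (K : pzRingType) (U V W : lmodType K) (f : U -> V -> W) :=
  (forall v, linear (fun u => f u v)) /\ (forall u, linear (f u)).

Section LinearFacts.
Context (K : pzRingType) (U V : lmodType K) (f : U -> V).
Hypothesis lin_f : linear f.

Lemma lin0 : f 0 = 0.
Proof. by have := lin_f (-1) 0 0; rewrite scaler0 addr0 scaleN1r addNr. Qed.

Lemma linD u v : f (u + v) = f u + f v.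
Proof. by have := lin_f 1 u v; rewrite !scale1r. Qed.

Lemma linZ k u : f (k *: u) = k *: f u.
Proof. by have := lin_f k u 0; rewrite lin0 !addr0. Qed.

Lemma linN u : f (- u) = - f u.
Proof. by rewrite -scaleN1r linZ scaleN1r. Qed.

Lemma lin_sum I (r : seq I) (P : pred I) F :
  f (\sum_(i <- r | P i) F i) = \sum_(i <- r | P i) f (F i).
Proof. exact: (big_morph f linD lin0). Qed.

End LinearFacts.

(******************************************************************************)
(* The tensor product: formal sums of pairs, i.e. elements of the free        *)
(* commutative monoid on U * V, modulo the congruence generated by the        *)
(* bilinearity relations.                                                     *)
(******************************************************************************)

Section Tensor.
Context (K : comPzRingType) (U V : lmodType K).

Inductive teq : seq (U * V) -> seq (U * V) -> Prop :=
| teq_refl s : teq s s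
| teq_sym s t : teq s t -> teq t s
| teq_trans s t r : teq s t -> teq t r -> teq s r
| teq_cat s s' t t' : teq s s' -> teq t t' -> teq (s ++ t) (s' ++ t')
| teq_catC s t : teq (s ++ t) (t ++ s)
| teq_addl u u' v : teq [:: (u + u', v)] [:: (u, v); (u', v)]
| teq_addr u v v' : teq [:: (u, v + v')] [:: (u, v); (u, v')]
| teq_scale k u v : teq [:: (k *: u, v)] [:: (u, k *: v)]
| teq_0l v : teq [:: (0, v)] [::].

Definition teqb s t := `[< teq s t >].

Lemma teqb_refl : reflexive teqb.
Proof. by move=> s; apply/asboolP/teq_refl. Qed.

Lemma teqb_sym : symmetric teqb.
Proof. by move=> s t; apply/asboolP/asboolP => /teq_sym. Qed.

Lemma teqb_trans : transitive teqb.
Proof.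
by move=> t s r /asboolP st /asboolP tr; apply/asboolP/(teq_trans st tr).
Qed.

Canonical teq_equiv := EquivRel teqb teqb_refl teqb_sym teqb_trans.

Definition tensor := {eq_quot teqb}.
HB.instance Definition _ := Choice.on tensor.

Definition tclass (s : seq (U * V)) : tensor := \pi_tensor s.

Lemma tclassP s t : tclass s = tclass t <-> teq s t.
Proof.
split; first by move/eqmodP/asboolP.
by move=> st; apply/eqmodP/asboolP.
Qed.

Lemma treprK x : tclass (repr x) = x.
Proof. exact: reprK. Qed.

Lemma teq_repr s : teq (repr (tclass s)) s.
Proof. by apply/tclassP; rewrite treprK. Qed.

Definition scale_pairs k (s : seq (U * V)) := [seq (k *: z.1, z.2) | z <- s].

Definition tadd (x y : tensor) := tclass (repr x ++ repr y).
Definition tscale k (x : tensor) := tclass (scale_pairs k (repr x)).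

Lemma teq_0r u : teq [:: (u, 0)] [::].
Proof.
have := teq_scale 0 u 0; rewrite scale0r scaler0 => /teq_sym h.
exact: teq_trans h (teq_0l _).
Qed.

Lemma scale_pairs_teq k s t : teq s t -> teq (scale_pairs k s) (scale_pairs k t).
Proof.
rewrite /scale_pairs; elim=> {s t} /=.
- by move=> s; apply: teq_refl.
- by move=> s t _; apply: teq_sym.
- by move=> s t r _ h _; apply: teq_trans.
- by move=> s s' t t' _ h _ h'; rewrite !map_cat; apply: teq_cat.
- by move=> s t; rewrite !map_cat; apply: teq_catC.
- by move=> u u' v; rewrite scalerDr; apply: teq_addl.
- by move=> u v v'; apply: teq_addr.
- move=> l u v; rewrite scalerA mulrC -scalerA; exact: teq_scale.
- by move=> v; rewrite scaler0; apply: teq_0l.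
Qed.

Lemma tclassD s t : tadd (tclass s) (tclass t) = tclass (s ++ t).
Proof. by apply/tclassP/teq_cat; apply: teq_repr. Qed.

Lemma tclassZ k s : tscale k (tclass s) = tclass (scale_pairs k s).
Proof. by apply/tclassP/scale_pairs_teq/teq_repr. Qed.

Lemma tensor_classP (P : tensor -> Prop) : (forall s, P (tclass s)) -> forall x, P x.
Proof. by move=> h x; rewrite -(treprK x). Qed.

Lemma taddA : associative tadd.
Proof.
elim/tensor_classP=> s; elim/tensor_classP=> t; elim/tensor_classP=> r.
by rewrite !tclassD catA.
Qed.

Lemma taddC : commutative tadd.
Proof.
elim/tensor_classP=> s; elim/tensor_classP=> t.
by rewrite !tclassD; apply/tclassP/teq_catC.
Qed.

Lemma tadd0 : left_id (tclass [::]) tadd.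
Proof. by elim/tensor_classP=> s; rewrite tclassD. Qed.

HB.instance Definition _ := GRing.isNmodule.Build tensor taddA taddC tadd0.

Definition pure u v : tensor := tclass [:: (u, v)].

Lemma tclass0 : tclass [::] = 0. Proof. by []. Qed.

Lemma tclass_cat s t : tclass (s ++ t) = tclass s + tclass t.
Proof. by rewrite -tclassD. Qed.

Lemma tclass_cons z s : tclass (z :: s) = pure z.1 z.2 + tclass s.
Proof. by rewrite /pure -surjective_pairing -tclass_cat. Qed.

Lemma pure_addl u u' v : pure (u + u') v = pure u v + pure u' v.
Proof. by rewrite -tclass_cat; apply/tclassP/teq_addl. Qed.

Lemma pure_addr u v v' : pure u (v + v') = pure u v + pure u v'.
Proof. by rewrite -tclass_cat; apply/tclassP/teq_addr. Qed.

Lemma pure_scale k u v : pure (k *: u) v = pure u (k *: v).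
Proof. exact/tclassP/teq_scale. Qed.

Lemma pure0l v : pure 0 v = 0.
Proof. exact/tclassP/teq_0l. Qed.

Lemma tscale_nil k : tscale k 0 = 0.
Proof. exact: (tclassZ k [::]). Qed.

Lemma tscale_cons k z s :
  tscale k (tclass (z :: s)) = pure (k *: z.1) z.2 + tscale k (tclass s).
Proof. by rewrite !tclassZ /= tclass_cons. Qed.

Lemma taddN : left_inverse 0 (tscale (-1)) +%R.
Proof.
elim/tensor_classP; elim=> [|z s ih]; first by rewrite tscale_nil addr0.
rewrite tscale_cons tclass_cons addrACA ih addr0 -pure_addl.
by rewrite scaleN1r addNr pure0l.
Qed.

HB.instance Definition _ := GRing.Nmodule_isZmodule.Build tensor taddN.

Lemma tscaleA k l x : tscale k (tscale l x) = tscale (k * l) x.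
Proof.
move: x; elim/tensor_classP=> s; rewrite !tclassZ; congr tclass.
by rewrite /scale_pairs -map_comp; apply: eq_map => z /=; rewrite scalerA.
Qed.

Lemma tscale1 : left_id 1 tscale.
Proof.
elim/tensor_classP=> s; rewrite tclassZ; congr tclass.
by rewrite -[RHS]map_id; apply: eq_map => -[u v] /=; rewrite scale1r.
Qed.

Lemma tscaleDr : right_distributive tscale +%R.
Proof.
move=> k; elim/tensor_classP=> s; elim/tensor_classP=> t.
by rewrite -tclass_cat !tclassZ -tclass_cat /scale_pairs map_cat.
Qed.

Lemma tscaleDl x : {morph tscale^~ x : k l / k + l}.
Proof.
move=> k l; move: x; elim/tensor_classP; elim=> [|z s ih].
  by rewrite !tscale_nil addr0.
by rewrite !tscale_cons ih scalerDl pure_addl addrACA.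
Qed.

HB.instance Definition _ := GRing.Zmodule_isLmodule.Build K tensor
  tscaleA tscale1 tscaleDr tscaleDl.

Lemma pure_bilin : bilin pure.
Proof.
have scl k u v : pure (k *: u) v = k *: pure u v by rewrite /GRing.scale /= tclassZ.
split=> [v|u] k w w'; first by rewrite pure_addl scl.
by rewrite pure_addr -pure_scale scl.
Qed.

Lemma tclassE s : tclass s = \sum_(z <- s) pure z.1 z.2.
Proof. by elim: s => [|z s ih]; rewrite ?big_nil // big_cons tclass_cons ih. Qed.

Lemma tensorE x : x = \sum_(z <- repr x) pure z.1 z.2.
Proof. by rewrite -tclassE treprK. Qed.

Lemma tensor_ind (P : tensor -> Prop) :
  (forall u v, P (pure u v)) -> (forall x y, P x -> P y -> P (x + y)) ->
  P 0 -> forall x, P x.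
Proof. by move=> Pp PD P0 x; rewrite (tensorE x); apply: big_ind. Qed.

(* The linear map induced by f. The definition makes sense for every f but is
   meaningful only when f is bilinear. *)
Definition tlift (W : lmodType K) (f : U -> V -> W) (x : tensor) : W :=
  \sum_(z <- repr x) f z.1 z.2.

Section Lift.
Context (W : lmodType K) (f : U -> V -> W).
Hypothesis bil_f : bilin f.

Lemma tlift_class s : tlift f (tclass s) = \sum_(z <- s) f z.1 z.2.
Proof.
have [fl fr] := bil_f.
suff main t t' : teq t t' -> \sum_(z <- t) f z.1 z.2 = \sum_(z <- t') f z.1 z.2.
  exact/main/teq_repr.
elim=> {t t'} [//|s1 s2 _ ->//|s1 s2 s3 _ -> _ ->//|s1 s2 s3 s4 _ h _ h'|s1 s2||||];
  rewrite ?big_cat /=.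
- by rewrite h h'.
- by rewrite addrC.
- by move=> u u' v; rewrite !big_cons !big_nil !addr0 /= (linD (fl v)).
- by move=> u v v'; rewrite !big_cons !big_nil !addr0 /= (linD (fr u)).
- by move=> k u v; rewrite !big_seq1 /= (linZ (fl v)) (linZ (fr u)).
- by move=> v; rewrite big_seq1 big_nil; exact: (lin0 (fl v)).
Qed.

Lemma tliftE u v : tlift f (pure u v) = f u v.
Proof. by rewrite tlift_class big_seq1. Qed.

Lemma tlift_linear : linear (tlift f).
Proof.
have [fl fr] := bil_f; move=> k x y; move: x y.
elim/tensor_classP=> s; elim/tensor_classP=> t.
rewrite [k *: _]tclassZ -tclass_cat !tlift_class big_cat /= big_map; congr (_ + _).
by rewrite scaler_sumr; apply: eq_bigr => z _ /=; rewrite (linZ (fl _)).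
Qed.

End Lift.

Lemma tensor_ext (W : lmodType K) (f g : tensor -> W) : linear f -> linear g ->
  (forall u v, f (pure u v) = g (pure u v)) -> f =1 g.
Proof.
move=> lf lg fg; elim/tensor_ind => [//|x y fx fy|]; last by rewrite !lin0.
by rewrite (linD lf) (linD lg) fx fy.
Qed.

End Tensor.

Notation "u \ox v" := (pure u v) (at level 40, left associativity) : ring_scope.

Section TensorMaps.
Context (K : comPzRingType).
Implicit Types U V W X : lmodType K.

Definition tmap U V U' V' (f : U -> U') (g : V -> V') : tensor U V -> tensor U' V' :=
  tlift (fun u v => f u \ox g v).

Definition tflip U V : tensor U V -> tensor V U := tlift (fun u v => v \ox u).

Definition tlift3 U V W X (f : U -> V -> W -> X) : tensor U (tensor V W) -> X :=
  tlift (fun u y => tlift (f u) y).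

Definition trilin U V W X (f : U -> V -> W -> X) :=
  (forall v w, linear (fun u => f u v w)) /\ (forall u, bilin (f u)).

Lemma tlift3_bilin U V W X (f : U -> V -> W -> X) : trilin f ->
  bilin (fun u (y : tensor V W) => tlift (f u) y).
Proof.
case=> fl fb; split=> [y|u]; last exact: tlift_linear.
move=> k u u'; rewrite /tlift scaler_sumr -big_split.
by apply: eq_bigr => z _; exact: fl.
Qed.

Lemma tlift3_linear U V W X (f : U -> V -> W -> X) :
  trilin f -> linear (tlift3 f).
Proof. by move=> ft; apply: tlift_linear; exact: tlift3_bilin. Qed.

Lemma tlift3E U V W X (f : U -> V -> W -> X) u v w : trilin f ->
  tlift3 f (u \ox (v \ox w)) = f u v w.
Proof.
by move=> ft; rewrite /tlift3 (tliftE (tlift3_bilin ft)) (tliftE (ft.2 u)).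
Qed.

Lemma tensor3_ext U V W X (f g : tensor U (tensor V W) -> X) :
  linear f -> linear g ->
  (forall u v w, f (u \ox (v \ox w)) = g (u \ox (v \ox w))) -> f =1 g.
Proof.
move=> lf lg fg; apply: tensor_ext => // u.
have [_ pr] := @pure_bilin K U (tensor V W).
apply: (@tensor_ext _ _ _ _ (fun y => f (u \ox y)) (fun y => g (u \ox y)));
  by [move=> k y y'; rewrite pr (lf, lg) | exact: fg].
Qed.

Definition tassocl U V W : tensor U (tensor V W) -> tensor (tensor U V) W :=
  tlift3 (fun u v w => (u \ox v) \ox w).

Definition tassocr U V W : tensor (tensor U V) W -> tensor U (tensor V W) :=
  tlift (fun x w => tlift (fun u v => u \ox (v \ox w)) x).

End TensorMaps.

(* gr p is the homogeneous component of degree p; gr_dec and gr_free say that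
   the algebra is the internal direct sum of these components. No unit. *)
Record gradedAlgebra (K : comPzRingType) := GradedAlgebra {
  ga_mod :> lmodType K;
  gmul : ga_mod -> ga_mod -> ga_mod;
  gr : int -> ga_mod -> Prop;
  gmul_bilin : bilin gmul;
  gmulA : associative gmul;
  gr0 : forall p, gr p 0;
  gr_lin : forall p k x y, gr p x -> gr p y -> gr p (k *: x + y);
  gr_dec : forall x, exists (s : seq int) (f : int -> ga_mod),
    [/\ uniq s, forall p, gr p (f p) & x = \sum_(p <- s) f p];
  gr_free : forall (s : seq int) (f : int -> ga_mod),
    uniq s -> (forall p, gr p (f p)) -> \sum_(p <- s) f p = 0 ->
    forall p, p \in s -> f p = 0;
  gr_mul : forall p q x y, gr p x -> gr q y -> gr (p + q) (gmul x y) }.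

Arguments gr {K} A p x : rename.

Notation "x ** y" := (gmul x y) (at level 40, left associativity) : ring_scope.

(* No counit, no grading. *)
Record coalgebra (K : comPzRingType) := Coalgebra {
  co_mod :> lmodType K;
  comul : {linear co_mod -> tensor co_mod co_mod};
  comulA : forall x, tassocl (tmap id comul (comul x)) = tmap comul id (comul x) }.

Arguments comul {K} c.

(* x |-> x^1 (x) (x^2 (x) x^3) *)
Definition comul3 (K : comPzRingType) (M : coalgebra K) (x : M) :
  tensor M (tensor M M) := tmap id (comul M) (comul M x).

Definition ksign (K : pzRingType) (t : int) : K := (-1) ^+ `|t|%N.
Arguments ksign {K} t.

Section Components.
Context (K : comPzRingType) (A : gradedAlgebra K).
Implicit Types (x y : A) (s : seq int).

Lemma gr_decP x : exists sf : seq int * (int -> A),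
  [/\ uniq sf.1, forall p, gr A p (sf.2 p) & x = \sum_(p <- sf.1) sf.2 p].
Proof. by have [s [f h]] := gr_dec x; exists (s, f). Qed.

Definition hsupp x : seq int := (projT1 (cid (gr_decP x))).1.

(* The homogeneous component of degree p. *)
Definition hc p x : A :=
  if p \in hsupp x then (projT1 (cid (gr_decP x))).2 p else 0.

Lemma hsupp_uniq x : uniq (hsupp x).
Proof. by rewrite /hsupp; case: cid => sf []. Qed.

Lemma hc_gr p x : gr A p (hc p x).
Proof.
by rewrite /hc; case: ifP => _; [case: cid => sf [] | exact: gr0].
Qed.

Lemma hc_sum x : x = \sum_(p <- hsupp x) hc p x.
Proof.
rewrite big_seq; under eq_bigr => p ps do rewrite /hc ps.
by rewrite -big_seq /hsupp; case: cid => sf [].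
Qed.

Lemma hc_notin p x : p \notin hsupp x -> hc p x = 0.
Proof. by rewrite /hc => /negbTE ->. Qed.

Lemma sum_sub s s' (f : int -> A) : uniq s -> uniq s' -> {subset s <= s'} ->
  (forall p, p \notin s -> f p = 0) -> \sum_(p <- s') f p = \sum_(p <- s) f p.
Proof.
move=> us us' ss' f0; rewrite (bigID (mem s)) /= [X in _ + X]big1 ?addr0 => [|p /f0 //].
rewrite -big_filter; apply: perm_big; apply: uniq_perm; rewrite ?filter_uniq //.
by move=> p; rewrite mem_filter; case: (boolP (p \in s)) => // /ss' ->.
Qed.

Lemma hc_sumW s x : uniq s -> {subset hsupp x <= s} -> x = \sum_(p <- s) hc p x.
Proof.
move=> us sub; rewrite (sum_sub (hsupp_uniq x) us sub) -?hc_sum //.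
by move=> p; exact: hc_notin.
Qed.

Lemma hc_uniq s (f : int -> A) : uniq s -> (forall p, gr A p (f p)) ->
  forall p, hc p (\sum_(q <- s) f q) = if p \in s then f p else 0.
Proof.
move=> us fg p; set x := \sum_(q <- s) f q.
pose g q := if q \in s then f q else 0.
have gg q : gr A q (g q) by rewrite /g; case: ifP => _ //; exact: gr0.
pose s' := undup (s ++ hsupp x).
have us' : uniq s' by exact: undup_uniq.
have xg : x = \sum_(q <- s') g q.
  rewrite (@sum_sub s s') //; first 1 last.
  - by move=> q qs; rewrite mem_undup mem_cat qs.
  - by move=> q /negbTE qs; rewrite /g qs.
  by rewrite /x big_seq [RHS]big_seq; apply: eq_bigr => q qs; rewrite /g qs.
have xh : x = \sum_(q <- s') hc q x.
  by apply: hc_sumW => // q qs; rewrite mem_undup mem_cat qs orbT.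
have dg q : gr A q (-1 *: g q + hc q x) by apply: gr_lin => //; exact: hc_gr.
have d0 : \sum_(q <- s') (-1 *: g q + hc q x) = 0.
  by rewrite big_split /= -scaler_sumr -xg -xh scaleN1r addNr.
case: (boolP (p \in s')) => [ps|]; last first.
  rewrite mem_undup mem_cat negb_or => /andP[/negbTE -> /hc_notin //].
have /eqP := gr_free us' dg d0 ps.
by rewrite scaleN1r addrC subr_eq0 => /eqP.
Qed.

Lemma hc_linear p : linear (hc p).
Proof.
move=> k x y; pose s := undup (hsupp x ++ hsupp y).
have us : uniq s by exact: undup_uniq.
have ex : x = \sum_(q <- s) hc q x.
  by apply: hc_sumW => // q qs; rewrite mem_undup mem_cat qs.
have ey : y = \sum_(q <- s) hc q y.
  by apply: hc_sumW => // q qs; rewrite mem_undup mem_cat qs orbT.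
have -> : k *: x + y = \sum_(q <- s) (k *: hc q x + hc q y).
  by rewrite big_split /= -scaler_sumr -ex -ey.
rewrite hc_uniq // => [|q]; last by apply: gr_lin; exact: hc_gr.
case: ifP => //; rewrite mem_undup mem_cat => /norP[/hc_notin -> /hc_notin ->].
by rewrite scaler0 addr0.
Qed.

Lemma hc_hom p q x : gr A p x -> hc q x = if q == p then x else 0.
Proof.
move=> px; pose f r := if r == p then x else 0.
have fg r : gr A r (f r) by rewrite /f; case: eqP => [->//|_]; exact: gr0.
have -> : x = \sum_(r <- [:: p]) f r by rewrite big_seq1 /f eqxx.
by rewrite (@hc_uniq [:: p]) // big_seq1 mem_seq1 /f eqxx; case: eqP.
Qed.

Lemma hc_pick (W : nmodType) (F : A -> W) p x : F 0 = 0 ->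
  \sum_(q <- hsupp x | q == p) F (hc q x) = F (hc p x).
Proof.
move=> F0; rewrite big_mkcond; case: (boolP (p \in hsupp x)) => ps.
  rewrite (bigD1_seq p) ?hsupp_uniq //= eqxx big1 ?addr0 // => q.
  by move=> /negbTE ->.
rewrite (hc_notin ps) F0 big_seq big1 // => q qs; case: eqP => // qp.
by rewrite -qp qs in ps.
Qed.

Lemma hc_mul p x y :
  hc p (x ** y) = \sum_(i <- hsupp x) hc i x ** hc (p - i) y.
Proof.
have [ml mr] := gmul_bilin A.
rewrite {1}(hc_sum x) (lin_sum (ml y)) (lin_sum (@hc_linear p)).
apply: eq_bigr => i _; rewrite {1}(hc_sum y) (lin_sum (mr _)).
rewrite (lin_sum (@hc_linear p)) -(@hc_pick _ (fun z => hc i x ** z)).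
  rewrite [RHS]big_mkcond; apply: eq_bigr => j _.
  rewrite (hc_hom _ (gr_mul (hc_gr i x) (hc_gr j y))).
  by rewrite (eq_sym j) subr_eq [i + j]addrC.
exact: (lin0 (mr _)).
Qed.

(* Extension by linearity of a map given on homogeneous elements: F p is
   applied to the component of degree p. *)
Definition gext (W : lmodType K) (F : int -> A -> W) (x : A) : W :=
  \sum_(p <- hsupp x) F p (hc p x).

Lemma gext_hom (W : lmodType K) (F : int -> A -> W) p x :
  (forall p, linear (F p)) -> gr A p x -> gext F x = F p x.
Proof.
move=> Fl px; rewrite /gext.
under eq_bigr => q _ do rewrite (hc_hom q px).
case: (boolP (p \in hsupp x)) => ps.
  rewrite (bigD1_seq p) ?hsupp_uniq //= eqxx big1 ?addr0 // => q /negbTE ->.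
  exact: lin0.
have x0 : x = 0 by rewrite -(hc_notin ps) (hc_hom p px) eqxx.
rewrite big1 => [|q _]; first by rewrite x0 (lin0 (Fl p)).
by rewrite x0; case: ifP => _; exact: lin0.
Qed.

Lemma gext_linear (W : lmodType K) (F : int -> A -> W) :
  (forall p, linear (F p)) -> linear (gext F).
Proof.
move=> Fl.
have wide s x : uniq s -> {subset hsupp x <= s} ->
    gext F x = \sum_(p <- s) F p (hc p x).
  move=> us sub; rewrite (bigID (mem (hsupp x))) /= [X in _ + X]big1.
    rewrite addr0 -big_filter; apply: perm_big; apply: uniq_perm;
      rewrite ?filter_uniq ?hsupp_uniq // => p.
    by rewrite mem_filter; case: (boolP (p \in hsupp x)) => // /sub ->.
  by move=> p /hc_notin ->; exact: lin0.
move=> k x y; pose s := undup (hsupp x ++ hsupp y ++ hsupp (k *: x + y)).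
have us : uniq s by exact: undup_uniq.
rewrite !(wide s) //; try by move=> q qs; rewrite mem_undup !mem_cat qs ?orbT.
rewrite scaler_sumr -big_split /=; apply: eq_bigr => p _.
by rewrite hc_linear Fl.
Qed.

Lemma gext_linear_param (V W : lmodType K) (F : int -> A -> V -> W) x :
  (forall p x, linear (F p x)) -> linear (fun v => gext (fun p x => F p x v) x).
Proof.
move=> Fl k v v'; rewrite /gext scaler_sumr -big_split.
by apply: eq_bigr => p _; exact: Fl.
Qed.

Lemma gext_bilinl (V W : lmodType K) (F : int -> A -> V -> W) :
  (forall p, bilin (F p)) -> bilin (fun x v => gext (fun p x => F p x v) x).
Proof.
move=> Fb; split=> [v|x]; first by apply: gext_linear => p; exact: (Fb p).1.
by apply: gext_linear_param => p y; exact: (Fb p).2.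
Qed.

Lemma gext_bilinr (V W : lmodType K) (F : int -> V -> A -> W) :
  (forall p, bilin (F p)) -> bilin (fun v x => gext (fun p x => F p v x) x).
Proof.
move=> Fb; split=> [x|v]; last by apply: gext_linear => p; exact: (Fb p).2.
by apply: (@gext_linear_param _ _ (fun p x v => F p v x)) => p y; exact: (Fb p).1.
Qed.

End Components.

Section Components23.
Context (K : comPzRingType) (A : gradedAlgebra K) (W : lmodType K).

Definition gext2 (F : int -> int -> A -> A -> W) (a b : A) : W :=
  gext (fun p a => gext (fun q b => F p q a b) b) a.

Lemma gext2_bilin F : (forall p q, bilin (F p q)) -> bilin (gext2 F).
Proof.
by move=> Fb; apply: gext_bilinl => p; apply: gext_bilinr => q; exact: Fb.
Qed.

Lemma gext2E F p q a b : (forall p q, bilin (F p q)) ->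
  gr A p a -> gr A q b -> gext2 F a b = F p q a b.
Proof.
move=> Fb pa qb; rewrite /gext2 (gext_hom _ pa) => [|p'].
  by rewrite (gext_hom _ qb) // => q'; exact: (Fb p q').2.
by apply: (gext_bilinr _).1 => q'; exact: Fb.
Qed.

Definition gext3 (F : int -> int -> int -> A -> A -> A -> W) (a b c : A) : W :=
  gext2 (fun p q a b => gext (fun r c => F p q r a b c) c) a b.

Lemma gext3_trilin F : (forall p q r, trilin (F p q r)) -> trilin (gext3 F).
Proof.
move=> Ft.
have h p q c : bilin (fun a b => gext (fun r c => F p q r a b c) c).
  split=> [b|a].
    by apply: (gext_bilinr _).1 => r; split=> [x|x]; [exact: (Ft p q r).1 |
      exact: ((Ft p q r).2 x).2].
  by apply: (gext_bilinr _).1 => r; exact: (Ft p q r).2.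
split=> [b c|a]; first exact: (gext2_bilin (fun p q => h p q c)).1.
split=> [c|b]; first exact: (gext2_bilin (fun p q => h p q c)).2.
move=> k c c'; rewrite /gext3 /gext2.
apply: (@gext_linear_param _ _ _ _ (fun p a c =>
  gext (fun q b => gext (fun r c => F p q r a b c) c) b)) => p x.
apply: (@gext_linear_param _ _ _ _ (fun q b c =>
  gext (fun r c => F p q r x b c) c)) => q y.
by apply: gext_linear => r; exact: ((Ft p q r).2 x).2.
Qed.

Lemma gext3E F p q r a b c : (forall p q r, trilin (F p q r)) ->
  gr A p a -> gr A q b -> gr A r c -> gext3 F a b c = F p q r a b c.
Proof.
move=> Ft pa qb rc; rewrite /gext3.
rewrite (gext2E _ pa qb) => [|p' q'].
  by rewrite (gext_hom _ rc) // => r'; exact: ((Ft p q r').2 a).2.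
split=> [y|x].
  by apply: (gext_bilinr _).1 => r'; split=> [x|x]; [exact: (Ft p' q' r').1 |
    exact: ((Ft p' q' r').2 x).2].
by apply: (gext_bilinr _).1 => r'; exact: (Ft p' q' r').2.
Qed.

End Components23.

(******************************************************************************)
(* The representation algebra, presented by generators and relations: terms   *)
(* in the generators modulo the smallest congruence that satisfies the laws   *)
(* of (nonunital) associative K-algebras and the defining relations.          *)
(******************************************************************************)

Section RepAlg.
Context (K : comPzRingType) (A : gradedAlgebra K) (M : coalgebra K).

Inductive rexp : Type :=
| Rgen of A & M
| R0
| Radd of rexp & rexp
| Rscale of K & rexp
| Rmul of rexp & rexp.

Definition Rcomul (a b : A) (s : seq (M * M)) : rexp :=
  foldr (fun z e => Radd (Rmul (Rgen a z.1) (Rgen b z.2)) e) R0 s.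

Inductive req : rexp -> rexp -> Prop :=
| req_refl x : req x x
| req_sym x y : req x y -> req y x
| req_trans x y z : req x y -> req y z -> req x z
| req_add x x' y y' : req x x' -> req y y' -> req (Radd x y) (Radd x' y')
| req_scale k x x' : req x x' -> req (Rscale k x) (Rscale k x')
| req_mul x x' y y' : req x x' -> req y y' -> req (Rmul x y) (Rmul x' y')
| req_addA x y z : req (Radd x (Radd y z)) (Radd (Radd x y) z)
| req_addC x y : req (Radd x y) (Radd y x)
| req_add0 x : req (Radd R0 x) x
| req_addN x : req (Radd (Rscale (-1) x) x) R0
| req_scaleA k l x : req (Rscale k (Rscale l x)) (Rscale (k * l) x)
| req_scale1 x : req (Rscale 1 x) x
| req_scaleDr k x y : req (Rscale k (Radd x y)) (Radd (Rscale k x) (Rscale k y))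
| req_scaleDl k l x : req (Rscale (k + l) x) (Radd (Rscale k x) (Rscale l x))
| req_mulA x y z : req (Rmul x (Rmul y z)) (Rmul (Rmul x y) z)
| req_mull k x y z :
    req (Rmul (Radd (Rscale k x) y) z) (Radd (Rscale k (Rmul x z)) (Rmul y z))
| req_mulr k x y z :
    req (Rmul z (Radd (Rscale k x) y)) (Radd (Rscale k (Rmul z x)) (Rmul z y))
| req_genl k a b al :
    req (Rgen (k *: a + b) al) (Radd (Rscale k (Rgen a al)) (Rgen b al))
| req_genr k a al be :
    req (Rgen a (k *: al + be)) (Radd (Rscale k (Rgen a al)) (Rgen a be))
| req_genM a b al s : comul M al = \sum_(z <- s) z.1 \ox z.2 ->
    req (Rgen (a ** b) al) (Rcomul a b s)
| req_genC p q a b al be : gr A p a -> gr A q b ->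
    req (Rmul (Rgen a al) (Rgen b be))
        (Rscale (ksign (p * q)) (Rmul (Rgen b be) (Rgen a al))).

HB.instance Definition _ := gen_eqMixin rexp.
HB.instance Definition _ := gen_choiceMixin rexp.

Definition reqb x y := `[< req x y >].

Lemma reqb_refl : reflexive reqb.
Proof. by move=> x; apply/asboolP/req_refl. Qed.

Lemma reqb_sym : symmetric reqb.
Proof. by move=> x y; apply/asboolP/asboolP => /req_sym. Qed.

Lemma reqb_trans : transitive reqb.
Proof.
by move=> y x z /asboolP xy /asboolP yz; apply/asboolP/(req_trans xy yz).
Qed.

Canonical req_equiv := EquivRel reqb reqb_refl reqb_sym reqb_trans.

Definition repMod := {eq_quot reqb}.
HB.instance Definition _ := Choice.on repMod.

Definition rclass (x : rexp) : repMod := \pi_repMod x.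

Lemma rclassP x y : rclass x = rclass y <-> req x y.
Proof.
split; first by move/eqmodP/asboolP.
by move=> xy; apply/eqmodP/asboolP.
Qed.

Lemma rreprK x : rclass (repr x) = x.
Proof. exact: reprK. Qed.

Lemma req_repr x : req (repr (rclass x)) x.
Proof. by apply/rclassP; rewrite rreprK. Qed.

Lemma rep_classP (P : repMod -> Prop) : (forall x, P (rclass x)) -> forall x, P x.
Proof. by move=> h x; rewrite -(rreprK x). Qed.

Definition radd (x y : repMod) := rclass (Radd (repr x) (repr y)).
Definition rscale k (x : repMod) := rclass (Rscale k (repr x)).
Definition rmul (x y : repMod) := rclass (Rmul (repr x) (repr y)).

Lemma rclassD x y : radd (rclass x) (rclass y) = rclass (Radd x y).
Proof. by apply/rclassP/req_add; exact: req_repr. Qed.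

Lemma rclassZ k x : rscale k (rclass x) = rclass (Rscale k x).
Proof. by apply/rclassP/req_scale; exact: req_repr. Qed.

Lemma rclassM x y : rmul (rclass x) (rclass y) = rclass (Rmul x y).
Proof. by apply/rclassP/req_mul; exact: req_repr. Qed.

Let rclassE := (rclassD, rclassZ, rclassM).

Lemma raddA : associative radd.
Proof.
elim/rep_classP=> x; elim/rep_classP=> y; elim/rep_classP=> z.
by rewrite !rclassE; apply/rclassP/req_addA.
Qed.

Lemma raddC : commutative radd.
Proof.
elim/rep_classP=> x; elim/rep_classP=> y.
by rewrite !rclassE; apply/rclassP/req_addC.
Qed.

Lemma radd0 : left_id (rclass R0) radd.
Proof. by elim/rep_classP=> x; rewrite !rclassE; apply/rclassP/req_add0. Qed.

Lemma raddN : left_inverse (rclass R0) (rscale (-1)) radd.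
Proof. by elim/rep_classP=> x; rewrite !rclassE; apply/rclassP/req_addN. Qed.

HB.instance Definition _ := GRing.isZmodule.Build repMod raddA raddC radd0 raddN.

Lemma rscaleA k l x : rscale k (rscale l x) = rscale (k * l) x.
Proof.
by move: x; elim/rep_classP=> x; rewrite !rclassE; apply/rclassP/req_scaleA.
Qed.

Lemma rscale1 : left_id 1 rscale.
Proof. by elim/rep_classP=> x; rewrite !rclassE; apply/rclassP/req_scale1. Qed.

Lemma rscaleDr : right_distributive rscale +%R.
Proof.
move=> k; elim/rep_classP=> x; elim/rep_classP=> y.
by rewrite /+%R /= !rclassE; apply/rclassP/req_scaleDr.
Qed.

Lemma rscaleDl x : {morph rscale^~ x : k l / k + l}.
Proof.
move=> k l; move: x; elim/rep_classP=> x.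
by rewrite [RHS]/+%R /= !rclassE; apply/rclassP/req_scaleDl.
Qed.

HB.instance Definition _ := GRing.Zmodule_isLmodule.Build K repMod
  rscaleA rscale1 rscaleDr rscaleDl.

Lemma rclass0 : rclass R0 = 0. Proof. by []. Qed.

Lemma rclass_add x y : rclass (Radd x y) = rclass x + rclass y.
Proof. by rewrite -rclassD. Qed.

Lemma rclass_scale k x : rclass (Rscale k x) = k *: rclass x.
Proof. by rewrite -rclassZ. Qed.

Lemma rmulA : associative rmul.
Proof.
elim/rep_classP=> x; elim/rep_classP=> y; elim/rep_classP=> z.
by rewrite !rclassE; apply/rclassP/req_mulA.
Qed.

Lemma rmul_bilin : bilin rmul.
Proof.
split=> [z|z] k x y; move: x y z.
  elim/rep_classP=> x; elim/rep_classP=> y; elim/rep_classP=> z.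
  rewrite -rclass_scale -rclass_add !rclassM -rclass_scale -rclass_add.
  exact/rclassP/req_mull.
elim/rep_classP=> x; elim/rep_classP=> y; elim/rep_classP=> z.
rewrite -rclass_scale -rclass_add !rclassM -rclass_scale -rclass_add.
exact/rclassP/req_mulr.
Qed.

Definition rgen (a : A) (al : M) : repMod := rclass (Rgen a al).

Lemma rgen_bilin : bilin rgen.
Proof.
split=> [al|a] k x y; rewrite /rgen -rclass_scale -rclass_add.
  exact/rclassP/req_genl.
exact/rclassP/req_genr.
Qed.

Lemma rgenM a b al s : comul M al = \sum_(z <- s) z.1 \ox z.2 ->
  rgen (a ** b) al = \sum_(z <- s) rmul (rgen a z.1) (rgen b z.2).
Proof.
move=> /(req_genM a b)/rclassP; rewrite -/(rgen _ _) => ->.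
elim: s => [|z s ih]; first by rewrite big_nil.
by rewrite big_cons -ih /= rclass_add rclassM.
Qed.

Lemma rgenC p q a b al be : gr A p a -> gr A q b ->
  rmul (rgen a al) (rgen b be) = ksign (p * q) *: rmul (rgen b be) (rgen a al).
Proof.
move=> pa qb; rewrite !rclassM -rclass_scale; exact/rclassP/req_genC.
Qed.

(* The smallest grading for which rgen a al has the degree of a. *)
Inductive rgr : int -> repMod -> Prop :=
| rgr_gen p a al : gr A p a -> rgr p (rgen a al)
| rgr_0 p : rgr p 0
| rgr_lin p k x y : rgr p x -> rgr p y -> rgr p (k *: x + y)
| rgr_mul p q x y : rgr p x -> rgr q y -> rgr (p + q) (rmul x y).

(* The homogeneous terms of an expression, used to show that the components
   rgr p are in direct sum. *)
Fixpoint rterms (e : rexp) : seq (int * repMod) :=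
  match e with
  | Rgen a al => [seq (p, rgen (hc p a) al) | p <- hsupp a]
  | R0 => [::]
  | Radd x y => rterms x ++ rterms y
  | Rscale k x => [seq (z.1, k *: z.2) | z <- rterms x]
  | Rmul x y => [seq (z.1 + w.1, rmul z.2 w.2) | z <- rterms x, w <- rterms y]
  end.

Definition rproj p (e : rexp) : repMod := \sum_(z <- rterms e | z.1 == p) z.2.

Lemma rproj_mul p x y :
  rproj p (Rmul x y) = \sum_(z <- rterms x) rmul z.2 (rproj (p - z.1) y).
Proof.
have [_ mr] := rmul_bilin.
rewrite /rproj /= big_mkcond big_allpairs_dep /=.
apply: eq_bigr => z _; rewrite (lin_sum (mr _)) [RHS]big_mkcond /=.
by apply: eq_bigr => w _; rewrite addrC -[_ == p]subr_eq0 -addrA -[in RHS]subr_eq0 opprB.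
Qed.

Lemma rproj_mul' p x y :
  rproj p (Rmul x y) = \sum_(w <- rterms y) rmul (rproj (p - w.1) x) w.2.
Proof.
have [ml _] := rmul_bilin.
rewrite /rproj /= big_mkcond big_allpairs_dep exchange_big /=.
apply: eq_bigr => w _; rewrite (lin_sum (ml _)) [RHS]big_mkcond /=.
by apply: eq_bigr => z _; rewrite -[_ == p]subr_eq0 -addrA -[in RHS]subr_eq0 opprB.
Qed.

Lemma rproj0 p : rproj p R0 = 0.
Proof. by rewrite /rproj big_nil. Qed.

Lemma rproj_add p x y : rproj p (Radd x y) = rproj p x + rproj p y.
Proof. by rewrite /rproj big_cat. Qed.

Lemma rproj_scale p k x : rproj p (Rscale k x) = k *: rproj p x.
Proof. by rewrite /rproj big_map scaler_sumr. Qed.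

Lemma rproj_gen p a al : rproj p (Rgen a al) = rgen (hc p a) al.
Proof.
have [gl _] := rgen_bilin; rewrite /rproj big_map /=.
by apply: (@hc_pick _ _ _ (fun x => rgen x al)); exact: (lin0 (gl al)).
Qed.

Lemma rproj_gen_mul p a b al be : rproj p (Rmul (Rgen a al) (Rgen b be)) =
  \sum_(i <- hsupp a) rmul (rgen (hc i a) al) (rgen (hc (p - i) b) be).
Proof.
by rewrite rproj_mul big_map; apply: eq_bigr => i _; rewrite rproj_gen.
Qed.

Lemma rproj_gen_hom r p q a b al be : gr A p a -> gr A q b ->
  rproj r (Rmul (Rgen a al) (Rgen b be)) =
  if r == p + q then rmul (rgen a al) (rgen b be) else 0.
Proof.
have [gl _] := rgen_bilin; have [ml mr] := rmul_bilin.
move=> pa qb; rewrite rproj_gen_mul.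
pose F x := rmul (rgen x al) (rgen (hc (r - p) b) be).
have F0 : F 0 = 0 by rewrite /F (lin0 (gl _)) (lin0 (ml _)).
transitivity (F (hc p a)).
  rewrite -(hc_pick _ _ F0) [RHS]big_mkcond; apply: eq_bigr => i _ /=.
  case: eqP => [->//|/eqP/negbTE ip]; rewrite (hc_hom _ pa) ip.
  by rewrite (lin0 (gl _)) (lin0 (ml _)).
rewrite /F (hc_hom _ pa) (hc_hom _ qb) eqxx subr_eq [q + p]addrC.
by case: ifP => // _; rewrite (lin0 (gl _)) (lin0 (mr _)).
Qed.

Lemma rproj_comul p a b s : rproj p (Rcomul a b s) =
  \sum_(z <- s) rproj p (Rmul (Rgen a z.1) (Rgen b z.2)).
Proof.
elim: s => [|z s ih]; first by rewrite big_nil rproj0.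
by rewrite big_cons -ih -rproj_add.
Qed.

Lemma rproj_req x y : req x y -> forall p, rproj p x = rproj p y.
Proof.
have [gl gR] := rgen_bilin; have [ml mr] := rmul_bilin.
elim=> {x y} //.
- by move=> x y z _ h _ h' p; rewrite h.
- by move=> x x' y y' _ h _ h' p; rewrite !rproj_add h h'.
- by move=> k x x' _ h p; rewrite !rproj_scale h.
- move=> x x' y y' _ h _ h' p; rewrite rproj_mul.
  under eq_bigr do rewrite h'.
  rewrite -rproj_mul rproj_mul'.
  under eq_bigr do rewrite h.
  by rewrite -rproj_mul'.
- by move=> x y z p; rewrite !rproj_add addrA.
- by move=> x y p; rewrite !rproj_add addrC.
- by move=> x p; rewrite rproj_add rproj_scale scaleN1r addNr rproj0.
- by move=> k l x p; rewrite !rproj_scale scalerA.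
- by move=> x p; rewrite !rproj_scale scale1r.
- by move=> k x y p; rewrite !(rproj_scale, rproj_add) scalerDr.
- by move=> k l x p; rewrite !(rproj_scale, rproj_add) scalerDl.
- move=> x y z p; rewrite rproj_mul [RHS]rproj_mul.
  rewrite [in RHS]/= big_allpairs_dep /=; apply: eq_bigr => t _.
  rewrite rproj_mul (lin_sum (mr _)); apply: eq_bigr => w _.
  by rewrite rmulA opprD addrA.
- move=> k x y z p; rewrite !(rproj_scale, rproj_add) !rproj_mul'.
  rewrite scaler_sumr -big_split; apply: eq_bigr => w _ /=.
  by rewrite rproj_add rproj_scale ml.
- move=> k x y z p; rewrite !(rproj_scale, rproj_add) !rproj_mul.
  rewrite scaler_sumr -big_split; apply: eq_bigr => w _ /=.
  by rewrite rproj_add rproj_scale mr.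
- move=> k a b al p; rewrite !(rproj_scale, rproj_add) !rproj_gen.
  by rewrite hc_linear gl.
- by move=> k a al be p; rewrite !(rproj_scale, rproj_add) !rproj_gen gR.
- move=> a b al s als p; rewrite rproj_gen rproj_comul hc_mul (lin_sum (gl _)).
  under [RHS]eq_bigr do rewrite rproj_gen_mul.
  rewrite exchange_big /=; apply: eq_bigr => i _.
  exact: rgenM.
- move=> p q a b al be pa qb r; rewrite rproj_scale.
  rewrite (rproj_gen_hom _ _ _ pa qb) (rproj_gen_hom _ _ _ qb pa) [q + p]addrC.
  by case: ifP => _; rewrite ?scaler0 // (rgenC _ _ pa qb).
Qed.

Definition rcomp p (x : repMod) := rproj p (repr x).

Lemma rcomp_class p e : rcomp p (rclass e) = rproj p e.
Proof. by apply: rproj_req; exact: req_repr. Qed.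

Lemma rcomp_linear p : linear (rcomp p).
Proof.
move=> k x y; move: x y; elim/rep_classP=> x; elim/rep_classP=> y.
by rewrite -rclass_scale -rclass_add !rcomp_class rproj_add rproj_scale.
Qed.

Lemma rcomp_hom p x : rgr p x -> forall q, rcomp q x = if q == p then x else 0.
Proof.
have [gl _] := rgen_bilin; have [ml mr] := rmul_bilin.
elim=> {p x}.
- move=> p a al pa q; rewrite rcomp_class rproj_gen (hc_hom _ pa).
  by case: ifP => // _; rewrite (lin0 (gl _)).
- by move=> p q; rewrite (lin0 (@rcomp_linear q)) if_same.
- move=> p k x y _ hx _ hy q; rewrite rcomp_linear hx hy.
  by case: ifP => // _; rewrite scaler0 addr0.
move=> p q x y _ hx _ hy r; rewrite rcomp_class rproj_mul.
rewrite (eq_bigr (fun z => if z.1 == r - q then rmul z.2 y else 0)); last first.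
  move=> z _; rewrite [rproj _ _]hy subr_eq addrC -subr_eq eq_sym.
  by case: ifP => // _; exact: (lin0 (mr _)).
rewrite -big_mkcond -(lin_sum (ml y)) -/(rproj _ _) [rproj _ _]hx subr_eq.
by case: ifP => // _; exact: (lin0 (ml _)).
Qed.

Lemma rterms_gr e z : z \in rterms e -> rgr z.1 z.2.
Proof.
elim: e z => [a al||x hx y hy|k x hx|x hx y hy] z //=.
- by case/mapP=> p _ ->; apply: rgr_gen; exact: hc_gr.
- by rewrite mem_cat => /orP[/hx|/hy].
- case/mapP=> w /hx h ->; rewrite -[_ *: _]addr0.
  by apply: rgr_lin h _; exact: rgr_0.
by case/allpairsPdep=> [t [w [/hx ht /hy hw ->]]]; exact: rgr_mul.
Qed.

Lemma rterms_sum e : rclass e = \sum_(z <- rterms e) z.2.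
Proof.
have [gl _] := rgen_bilin; have [ml mr] := rmul_bilin.
elim: e => [a al||x hx y hy|k x hx|x hx y hy] /=.
- by rewrite big_map -(lin_sum (gl al)) -hc_sum.
- by rewrite big_nil.
- by rewrite rclass_add big_cat hx hy.
- by rewrite rclass_scale hx big_map scaler_sumr.
rewrite -rclassM hx hy (lin_sum (ml _)) big_allpairs_dep.
by apply: eq_bigr => z _; rewrite (lin_sum (mr _)).
Qed.

Lemma rgr_sum p I (r : seq I) (P : pred I) (F : I -> repMod) :
  (forall i, P i -> rgr p (F i)) -> rgr p (\sum_(i <- r | P i) F i).
Proof.
move=> h; apply: big_ind => //; first exact: rgr_0.
by move=> x y px py; rewrite -[x]scale1r; exact: rgr_lin.
Qed.

Lemma rgr_dec x : exists (s : seq int) (f : int -> repMod),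
  [/\ uniq s, forall p, rgr p (f p) & x = \sum_(p <- s) f p].
Proof.
move: x; elim/rep_classP=> e.
pose s := undup [seq z.1 | z <- rterms e].
exists s, (fun p => rproj p e); split; first exact: undup_uniq.
  move=> p; rewrite /rproj big_seq_cond; apply: rgr_sum => z.
  by case/andP=> /rterms_gr h /eqP <-.
under eq_bigr do rewrite /rproj big_mkcond.
rewrite exchange_big /= rterms_sum big_seq [RHS]big_seq.
apply: eq_bigr => z ze; rewrite (bigD1_seq z.1) ?undup_uniq //=; last first.
  by rewrite mem_undup map_f.
by rewrite eqxx big1 ?addr0 // => q; rewrite eq_sym => /negbTE ->.
Qed.

Lemma rgr_free (s : seq int) (f : int -> repMod) :
  uniq s -> (forall p, rgr p (f p)) -> \sum_(p <- s) f p = 0 ->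
  forall p, p \in s -> f p = 0.
Proof.
move=> us fg f0 p ps; rewrite -(lin0 (@rcomp_linear p)) -f0.
rewrite (lin_sum (@rcomp_linear p)) (bigD1_seq p) //= (rcomp_hom (fg p)) eqxx.
rewrite big1 ?addr0 // => q qp; rewrite (rcomp_hom (fg q)) eq_sym.
by rewrite (negbTE qp).
Qed.

Definition repAlg : gradedAlgebra K :=
  GradedAlgebra rmul_bilin rmulA rgr_0 rgr_lin rgr_dec rgr_free rgr_mul.

Definition rep (a : A) (al : M) : repAlg := rgen a al.

End RepAlg.

Arguments repAlg {K} A M.

Section Gerstenhaber.
Context (K : comPzRingType) (n : int) (B : gradedAlgebra K).
Variable br : {linear tensor B B -> B}.

Local Notation "{ a , b }" := (br (a \ox b)).

Record biderivation : Prop := {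
  bd_deg : forall p q a b, gr B p a -> gr B q b -> gr B (p + q + n) {a, b};
  bd_mulr : forall p q r a b c, gr B p a -> gr B q b -> gr B r c ->
    {a, b ** c} = {a, b} ** c + ksign ((p + n) * q) *: (b ** {a, c});
  bd_mull : forall p q r a b c, gr B p a -> gr B q b -> gr B r c ->
    {a ** b, c} = a ** {b, c} + ksign (q * (r + n)) *: ({a, c} ** b);
  bd_skew : forall p q a b, gr B p a -> gr B q b ->
    {a, b} = - (ksign ((p + n) * (q + n)) *: {b, a}) }.

(* The value of the Jacobi form on elements of degrees p, q, r. *)
Definition jacobi (p q r : int) (a b c : B) : B :=
  ksign ((p + n) * (r + n)) *: {a, {b, c}} +
  ksign ((q + n) * (p + n)) *: {b, {c, a}} +
  ksign ((r + n) * (q + n)) *: {c, {a, b}}.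

Definition gerstenhaber : Prop :=
  biderivation /\
  forall p q r a b c, gr B p a -> gr B q b -> gr B r c -> jacobi p q r a b c = 0.

End Gerstenhaber.

Section DoubleBracket.
Context (K : comPzRingType) (n : int) (A : gradedAlgebra K).

(* The part of degree m of A (x) A. *)
Definition tens_gr (m : int) (x : tensor A A) : Prop :=
  exists s : seq (A * A),
    (forall z, z \in s ->
       exists i j, [/\ gr A i z.1, gr A j z.2 & i + j = m]) /\
    x = \sum_(z <- s) z.1 \ox z.2.

(* The operators P_{21,k}, P_{312,k} and P_{231,k}; the last one is the inverse
   of P_{312,k}, see P312K and P231K. *)
Definition P21 (k : int) : tensor A A -> tensor A A :=
  tlift (gext2 (fun p q a b => ksign ((p + k) * (q + k)) *: (b \ox a))).

Definition P312 (k : int) : tensor A (tensor A A) -> tensor A (tensor A A) :=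
  tlift3 (gext3 (fun p q r a b c =>
    ksign ((r + k) * (p + k) + (r + k) * (q + k)) *: (c \ox (a \ox b)))).

Definition P231 (k : int) : tensor A (tensor A A) -> tensor A (tensor A A) :=
  tlift3 (gext3 (fun p q r a b c =>
    ksign ((q + k) * (p + k) + (r + k) * (p + k)) *: (b \ox (c \ox a)))).

(* The outer bimodule structure, a (x (x) y) b = ax (x) yb. *)
Definition lact (a : A) (t : tensor A A) : tensor A A := tmap (gmul a) id t.
Definition ract (t : tensor A A) (b : A) : tensor A A :=
  tmap id (fun y => y ** b) t.

(* The inner bimodule structure: one-sided versions of
   a * (x (x) y) * b = (-1)^(|a||xb|+|b||y|) xb (x) ay. *)
Definition lstar (a : A) (t : tensor A A) : tensor A A :=
  tlift (fun x y => gext2 (fun p q a x => ksign (p * q) *: (x \ox (a ** y))) a x) t.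
Definition rstar (t : tensor A A) (b : A) : tensor A A :=
  tlift (fun x y => gext2 (fun p q b y => ksign (p * q) *: ((x ** b) \ox y)) b y) t.

Lemma scale_bilin (U V W : lmodType K) (f : U -> V -> W) k :
  bilin f -> bilin (fun u v => k *: f u v).
Proof.
case=> fl fr; split=> [v|u] l w w'; rewrite (fl, fr) scalerDr !scalerA;
  by rewrite [k * l]mulrC.
Qed.

Lemma pureP (U V : lmodType K) : bilin (fun u v => u \ox v : tensor U V).
Proof. exact: pure_bilin. Qed.

Lemma P21_bilin k p q :
  bilin (fun a b : A => ksign ((p + k) * (q + k)) *: (b \ox a)).
Proof.
by apply: scale_bilin; split=> [v|u]; [exact: (pureP _ _).2|exact: (pureP _ _).1].
Qed.

Lemma P21_linear k : linear (P21 k).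
Proof. by apply/tlift_linear/gext2_bilin => p q; exact: P21_bilin. Qed.

Lemma P21E k p q a b : gr A p a -> gr A q b ->
  P21 k (a \ox b) = ksign ((p + k) * (q + k)) *: (b \ox a).
Proof.
move=> pa qb; have h p' q' := P21_bilin k p' q'.
by rewrite /P21 (tliftE (gext2_bilin h)) (gext2E h pa qb).
Qed.

Lemma P312_trilin e : trilin (fun a b c : A => e *: (c \ox (a \ox b))).
Proof.
have [pl pr] := pureP A (tensor A A); have [ql qr] := pureP A A.
split=> [b c|a]; first by move=> l x y; rewrite ql pr scalerDr !scalerA [e * l]mulrC.
apply: (@scale_bilin _ _ _ (fun b c => c \ox (a \ox b))).
by split=> [c|b] l x y; rewrite ?qr ?pr ?pl.
Qed.

Lemma P231_trilin e : trilin (fun a b c : A => e *: (b \ox (c \ox a))).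
Proof.
have [pl pr] := pureP A (tensor A A); have [ql qr] := pureP A A.
split=> [b c|a]; first by move=> l x y; rewrite qr pr scalerDr !scalerA [e * l]mulrC.
apply: (@scale_bilin _ _ _ (fun b c => b \ox (c \ox a))).
by split=> [c|b] l x y; rewrite ?ql ?pr ?pl.
Qed.

Lemma P312E k p q r a b c : gr A p a -> gr A q b -> gr A r c ->
  P312 k (a \ox (b \ox c)) =
  ksign ((r + k) * (p + k) + (r + k) * (q + k)) *: (c \ox (a \ox b)).
Proof.
move=> pa qb rc; rewrite /P312 tlift3E ?(gext3E _ pa qb rc) //.
  by move=> p' q' r'; exact: P312_trilin.
by apply: gext3_trilin => p' q' r'; exact: P312_trilin.
Qed.

Lemma P231E k p q r a b c : gr A p a -> gr A q b -> gr A r c ->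
  P231 k (a \ox (b \ox c)) =
  ksign ((q + k) * (p + k) + (r + k) * (p + k)) *: (b \ox (c \ox a)).
Proof.
move=> pa qb rc; rewrite /P231 tlift3E ?(gext3E _ pa qb rc) //.
  by move=> p' q' r'; exact: P231_trilin.
by apply: gext3_trilin => p' q' r'; exact: P231_trilin.
Qed.

Lemma P312_linear k : linear (P312 k).
Proof.
by apply/tlift3_linear/gext3_trilin => p q r; exact: P312_trilin.
Qed.

Lemma P231_linear k : linear (P231 k).
Proof.
by apply/tlift3_linear/gext3_trilin => p q r; exact: P231_trilin.
Qed.

Lemma ksign_sq t : (ksign t * ksign t : K) = 1.
Proof. by rewrite /ksign -exprD -signr_odd oddD addbb. Qed.

(* A linear endomorphism of the third tensor power that fixes the tensors with
   homogeneous factors is the identity. *)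
Lemma hom3_id (f : tensor A (tensor A A) -> tensor A (tensor A A)) : linear f ->
  (forall p q r a b c, gr A p a -> gr A q b -> gr A r c ->
    f (a \ox (b \ox c)) = a \ox (b \ox c)) -> f =1 id.
Proof.
move=> lf fh; apply: tensor3_ext => // a b c.
have [pl pr] := pureP A (tensor A A); have [ql qr] := pureP A A.
rewrite (hc_sum a) (lin_sum (pl _)) (lin_sum lf); apply: eq_bigr => p _.
rewrite (hc_sum b) (lin_sum (ql _)) (lin_sum (pr _)) (lin_sum lf).
apply: eq_bigr => q _.
rewrite (hc_sum c) (lin_sum (qr _)) (lin_sum (pr _)) (lin_sum lf).
apply: eq_bigr => r _; apply: fh; exact: hc_gr.
Qed.

Lemma P312K k : cancel (P312 k) (P231 k).
Proof.
apply: (@hom3_id (fun x => P231 k (P312 k x))).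
  by move=> l x y; rewrite P312_linear P231_linear.
move=> p q r a b c pa qb rc.
rewrite (P312E _ pa qb rc) (linZ (@P231_linear k)) (P231E _ rc pa qb).
by rewrite scalerA [(p + k) * _]mulrC [(q + k) * _]mulrC ksign_sq scale1r.
Qed.

Lemma P231K k : cancel (P231 k) (P312 k).
Proof.
apply: (@hom3_id (fun x => P312 k (P231 k x))).
  by move=> l x y; rewrite P231_linear P312_linear.
move=> p q r a b c pa qb rc.
rewrite (P231E _ pa qb rc) (linZ (@P312_linear k)) (P312E _ qb rc pa).
by rewrite scalerA ![_ * (p + k)]mulrC ksign_sq scale1r.
Qed.

Lemma lstar_bilin (y : A) p q :
  bilin (fun a x : A => ksign (p * q) *: (x \ox (a ** y))).
Proof.
apply: scale_bilin; have [pl pr] := pureP A A; have [ml mr] := gmul_bilin A.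
by split=> [x|a] l u u'; rewrite ?ml ?pr ?pl.
Qed.

Lemma rstar_bilin (x : A) p q :
  bilin (fun b y : A => ksign (p * q) *: ((x ** b) \ox y)).
Proof.
apply: scale_bilin; have [pl pr] := pureP A A; have [ml mr] := gmul_bilin A.
by split=> [y|b] l u u'; rewrite ?mr ?pr ?pl.
Qed.

Lemma lstarE p q a x y : gr A p a -> gr A q x ->
  lstar a (x \ox y) = ksign (p * q) *: (x \ox (a ** y)).
Proof.
move=> pa qx; rewrite /lstar tliftE.
  by rewrite (gext2E (lstar_bilin y) pa qx).
split=> [y'|x']; first exact: (gext2_bilin (lstar_bilin y')).2.
apply: (@gext_linear_param _ _ _ _ (fun p a y => gext (fun q x =>
  ksign (p * q) *: (x \ox (a ** y))) x')) => p' b.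
apply: (@gext_linear_param _ _ _ _ (fun q x y =>
  ksign (p' * q) *: (x \ox (b ** y)))) => q' z l u u'.
have [_ pr] := pureP A A; have [_ mr] := gmul_bilin A.
by rewrite mr pr scalerDr !scalerA [_ * l]mulrC.
Qed.

Lemma rstarE p q b x y : gr A p b -> gr A q y ->
  rstar (x \ox y) b = ksign (p * q) *: ((x ** b) \ox y).
Proof.
move=> pb qy; rewrite /rstar tliftE.
  by rewrite (gext2E (rstar_bilin x) pb qy).
split=> [y'|x']; last exact: (gext2_bilin (rstar_bilin x')).2.
apply: (@gext_linear_param _ _ _ _ (fun p b x => gext (fun q y =>
  ksign (p * q) *: ((x ** b) \ox y)) y')) => p' z.
apply: (@gext_linear_param _ _ _ _ (fun q y x =>
  ksign (p' * q) *: ((x ** z) \ox y))) => q' w l u u'.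
have [pl _] := pureP A A; have [ml _] := gmul_bilin A.
by rewrite ml pl scalerDr !scalerA [_ * l]mulrC.
Qed.

Variable db : {linear tensor A A -> tensor A A}.

Local Notation "{{ a , b }}" := (db (a \ox b)).

Record double_bracket : Prop := {
  db_deg : forall p q a b, gr A p a -> gr A q b -> tens_gr (p + q + n) {{a, b}};
  db_skew : forall x, db (P21 n x) = - P21 0 (db x);
  db_mulr : forall p q r a b c, gr A p a -> gr A q b -> gr A r c ->
    {{a, b ** c}} = ract {{a, b}} c + ksign ((p + n) * q) *: lact b {{a, c}};
  db_mull : forall p q r a b c, gr A p a -> gr A q b -> gr A r c ->
    {{a ** b, c}} = lstar a {{b, c}} + ksign (q * (r + n)) *: rstar {{a, c}} b }.

Definition tribracket (x : tensor A (tensor A A)) : tensor A (tensor A A) :=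
  \sum_(i < 3) iter i (P312 0)
    (tassocr (tmap db id (tassocl (tmap id db (iter i (P231 n) x))))).

Definition double_gerstenhaber : Prop :=
  double_bracket /\ forall x, tribracket x = 0.

End DoubleBracket.

Section Induced.
Context (K : comPzRingType) (M : coalgebra K).
Variable v : {linear tensor M M -> K^o}.

Definition form_hat : tensor M M -> tensor M M :=
  tlift (fun al be =>
    tlift3 (fun b1 b2 b3 => (v (al \ox b2) : K) *: (b1 \ox b3)) (comul3 be)).

Definition cyclic_form : Prop :=
  forall x, form_hat (@tflip K M M x) = tflip (form_hat x).

Variables (n : int) (A : gradedAlgebra K) (db : {linear tensor A A -> tensor A A}).

Definition rep_bracket (a b : A) (al be : M) : repAlg A M :=
  tlift3 (fun b1 b2 b3 =>
    (v (al \ox b2) : K) *: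
    tlift (fun x y => rep x b1 ** rep y b3 : repAlg A M) (db (a \ox b)))
  (comul3 be).

(* br is the n-graded biderivation {-,-}_v in A_M; induced_biderivation_unique
   shows that it is determined by this property. *)
Definition induced_biderivation
    (br : {linear tensor (repAlg A M) (repAlg A M) -> repAlg A M}) : Prop :=
  biderivation n br /\
  forall a b al be, br (rep a al \ox rep b be) = rep_bracket a b al be.

Lemma induced_biderivation_unique br br' :
  induced_biderivation br -> induced_biderivation br' -> br =1 br'.
Proof.
case=> bd gE [bd' gE']; apply: tensor_ext; try exact: linearP.
have [pl pr] := pureP (repAlg A M) (repAlg A M).
have gen p (x : repAlg A M) b be : rgr p x -> forall q, gr A q b ->
    br (x \ox rep b be) = br' (x \ox rep b be).
  move=> px q qb; have gb : gr (repAlg A M) q (rep b be) by exact: rgr_gen.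
  elim: px => {p x} [p a al _|p|p k x y _ hx _ hy|p r x y px hx ry hy].
  - by rewrite [LHS]gE [RHS]gE'.
  - by rewrite (lin0 (pl _)) !linear0.
  - by rewrite pl !linearP hx hy.
  rewrite -[rmul x y]/((x : repAlg A M) ** y).
  by rewrite (bd_mull bd px ry gb) (bd_mull bd' px ry gb) hx hy.
have hom p q (x y : repAlg A M) : rgr p x -> rgr q y ->
    br (x \ox y) = br' (x \ox y).
  move=> px; elim=> {q y} [q b be qb|q|q k y z _ hy _ hz|q r y z qy hy rz hz].
  - exact: gen px _ qb.
  - by rewrite (lin0 (pr _)) !linear0.
  - by rewrite pr !linearP hy hz.
  rewrite -[rmul y z]/((y : repAlg A M) ** z).
  by rewrite (bd_mulr bd px qy rz) (bd_mulr bd' px qy rz) hy hz.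
move=> x y; rewrite (hc_sum x) (hc_sum y) (lin_sum (pl _)) !linear_sum.
apply: eq_bigr => p _; rewrite (lin_sum (pr _)) !linear_sum.
by apply: eq_bigr => q _; apply: hom; exact: (hc_gr (A := repAlg A M)).
Qed.

End Induced.

(* Main.v *)
Require Import Defs.
From mathcomp Require Import all_boot all_order all_algebra.
Set Implicit Arguments.
Unset Strict Implicit.
Unset Printing Implicit Defensive.
Import GRing.Theory.
Local Open Scope ring_scope.

(** For homogeneous a and b the Jacobi form is, up to a sign, the value at c of
      {a, {b, -}} - {{a, b}, -} - (-1)^(|a|_n |b|_n) {b, {a, -}},
    a graded commutator of derivations minus a derivation. So it vanishes at a
    product as soon as it vanishes at the factors; as it is also invariant under
    cyclic rotation of its arguments, it only has to be computed on the
    generators of the representation algebra ([jacobi_rep]).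

    On generators everything is governed by the sums
      form_sum f alpha mu = v(alpha (x) mu^2) f(mu^1, mu^3).
    Coassociativity lets two such sums be nested in either order ([form_sumA]),
    and cyclicity of v exchanges alpha and mu at the price of flipping f
    ([form_sumC]). For t = x (x) y (x) z in the third tensor power of A put
      T(alpha, beta, gamma; t)
        = v(alpha (x) gamma^2) v(beta (x) gamma^4)
          x_(gamma^1) y_(gamma^3) z_(gamma^5).
    By the two laws and the graded commutativity of the representation algebra,
      T(beta, gamma, alpha; t) = T(alpha, beta, gamma; P_312 t)
    ([rep_triple_rot]). Write X(a, b, c) for the image of a (x) b (x) c under
    the composite of two double brackets that occurs in the tribracket. The
    bracket {b_beta, c_gamma} is a sum of products x_(gamma^1) y_(gamma^3) with
    x (x) y in {{b, c}}. The two terms of the derivation rule for {a_alpha, -}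
    on such a product are again values of T, and the second one involves
    {{c, b}} because of the skew symmetry of the double bracket. The outcome is
    ([nested_bracket])
      {a_alpha, {b_beta, c_gamma}} = T(alpha, beta, gamma; X(a, b, c))
        - (-1)^(|b|_n |c|_n) T(alpha, gamma, beta; X(a, c, b)).
    In the Jacobi form the three first terms are, after rotation, the value of
    T(alpha, beta, gamma; -) on the tribracket of a, b, c, and the three second
    terms that of T(alpha, gamma, beta; -) on the tribracket of a, c, b, up to
    signs ([cyclic_triple]); both are zero. *)

(** * Signs *)

Lemma odd_abszD (s t : int) : odd (absz (s + t)) = odd `|s|%N (+) odd `|t|%N.
Proof.
have dist m k : odd (absz (Posz m - Posz k)) = odd m (+) odd k.
  wlog km : m k / (k <= m)%N => [h|].
    by case/orP: (leq_total k m) => /h //; rewrite distnC addbC.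
  by rewrite distnEl // oddB.
case: (intP s) => [|m|m]; case: (intP t) => [|k|k];
  rewrite ?(add0r, addr0, abszN, addbF) //.
- by rewrite -PoszD oddD.
- by rewrite addrC dist addbC.
- by rewrite -opprD abszN -PoszD oddD.
Qed.

Lemma ksign_odd (K : pzRingType) s t :
  odd `|s|%N = odd `|t|%N -> ksign s = ksign t :> K.
Proof. by rewrite /ksign -signr_odd => ->; rewrite signr_odd. Qed.

Lemma ksignD (K : pzRingType) s t : ksign (s + t) = ksign s * ksign t :> K.
Proof. by rewrite /ksign -signr_odd odd_abszD signr_addb !signr_odd. Qed.

(** Two sign exponents agree modulo 2: the parity of the exponent is a boolean
    polynomial in the parities of the degrees. *)
Ltac parity :=
  apply: ksign_odd; rewrite ?(odd_abszD, abszM, oddM, abszN);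
  repeat match goal with |- context [odd ?x] => case: (odd x) end; done.

(** * Linear maps on tensor products *)

Lemma linear_comp (K : pzRingType) (U V W : lmodType K) (f : U -> V) (g : V -> W) :
  linear f -> linear g -> linear (fun x => g (f x)).
Proof. by move=> lf lg k x y; rewrite lf lg. Qed.

Section TensorLift.
Context (K : comPzRingType) (U V W X : lmodType K).

Lemma tlift_comp (f : U -> V -> W) (g : W -> X) x : linear g ->
  g (tlift f x) = tlift (fun u v => g (f u v)) x.
Proof. by move=> lg; rewrite /tlift (lin_sum lg). Qed.

Lemma eq_tlift (f g : U -> V -> W) x :
  (forall u v, f u v = g u v) -> tlift f x = tlift g x.
Proof. by move=> fg; apply: eq_bigr => z _; exact: fg. Qed.

Lemma tlift_param (f : X -> U -> V -> W) x :
  (forall u v, linear (fun w => f w u v)) -> linear (fun w => tlift (f w) x).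
Proof.
move=> lf k w w'; rewrite /tlift scaler_sumr -big_split /=.
by apply: eq_bigr => z _; exact: lf.
Qed.

End TensorLift.

Lemma pure_linear_l (K : comPzRingType) (U V W : lmodType K) (f : W -> U) (v : V) :
  linear f -> linear (fun w => f w \ox v).
Proof. by move=> lf k x y; rewrite lf (pureP U V).1. Qed.

Lemma pure_linear_r (K : comPzRingType) (U V W : lmodType K) (f : W -> V) (u : U) :
  linear f -> linear (fun w => u \ox f w).
Proof. by move=> lf k x y; rewrite lf (pureP U V).2. Qed.

Lemma linear_id (K : pzRingType) (U : lmodType K) : linear (fun u : U => u).
Proof. by []. Qed.

Lemma tassocl_trilin (K : comPzRingType) (U V W : lmodType K) :
  trilin (fun (u : U) (v : V) (w : W) => (u \ox v) \ox w).
Proof.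
split=> [v w|u]; first exact/pure_linear_l/pure_linear_l/linear_id.
split=> [w|v]; first exact/pure_linear_l/pure_linear_r/linear_id.
exact/pure_linear_r/linear_id.
Qed.

Lemma tassocr_bilin (K : comPzRingType) (U V W : lmodType K) :
  bilin (fun (t : tensor U V) (w : W) => tlift (fun u v => u \ox (v \ox w)) t).
Proof.
split=> [w|t].
  apply: tlift_linear; split=> [v|u]; first exact/pure_linear_l/linear_id.
  exact/pure_linear_r/pure_linear_l/linear_id.
by apply: tlift_param => u v; exact/pure_linear_r/pure_linear_r/linear_id.
Qed.

Lemma tassocr_linear (K : comPzRingType) (U V W : lmodType K) :
  linear (@tassocr K U V W).
Proof. exact/tlift_linear/tassocr_bilin. Qed.

Lemma tassocrE (K : comPzRingType) (U V W : lmodType K) (u : U) (v : V) (w : W) :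
  tassocr ((u \ox v) \ox w) = u \ox (v \ox w).
Proof.
rewrite /tassocr (tliftE (@tassocr_bilin _ U V W)) tliftE //.
split=> [v'|u']; first exact/pure_linear_l/linear_id.
exact/pure_linear_r/pure_linear_l/linear_id.
Qed.

Lemma tassocr_pure_linear (K : comPzRingType) (U V W : lmodType K) (w : W) :
  linear (fun t : tensor U V => tassocr (t \ox w)).
Proof.
exact: linear_comp (pure_linear_l _ (@linear_id _ _)) (@tassocr_linear _ U V W).
Qed.

Lemma hom_tensor_ext (K : comPzRingType) (A : gradedAlgebra K) (W : lmodType K)
    (f g : tensor A A -> W) : linear f -> linear g ->
  (forall p q a b, gr A p a -> gr A q b -> f (a \ox b) = g (a \ox b)) -> f =1 g.
Proof.
move=> lf lg fg; apply: tensor_ext => // a b; have [pl pr] := pureP A A.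
rewrite (hc_sum a) (lin_sum (pl _)) (lin_sum lf) (lin_sum lg); apply: eq_bigr => p _.
rewrite (hc_sum b) (lin_sum (pr _)) (lin_sum lf) (lin_sum lg); apply: eq_bigr => q _.
by apply: fg; exact: hc_gr.
Qed.

Lemma hom_tensor3_ext (K : comPzRingType) (A : gradedAlgebra K) (W : lmodType K)
    (f g : tensor A (tensor A A) -> W) : linear f -> linear g ->
  (forall p q r a b c, gr A p a -> gr A q b -> gr A r c ->
    f (a \ox (b \ox c)) = g (a \ox (b \ox c))) -> f =1 g.
Proof.
move=> lf lg fg; apply: tensor3_ext => // a b c.
have [pl pr] := pureP A (tensor A A); have [ql qr] := pureP A A.
rewrite (hc_sum a) (lin_sum (pl _)) (lin_sum lf) (lin_sum lg); apply: eq_bigr => p _.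
rewrite (hc_sum b) (lin_sum (ql _)) (lin_sum (pr _)) (lin_sum lf) (lin_sum lg).
apply: eq_bigr => q _.
rewrite (hc_sum c) (lin_sum (qr _)) (lin_sum (pr _)) (lin_sum lf) (lin_sum lg).
by apply: eq_bigr => r _; apply: fg; exact: hc_gr.
Qed.

(** * Sweedler sums and cyclic forms *)

Section Sweedler.
Context (K : comPzRingType) (M : coalgebra K).
Implicit Type W : lmodType K.

Definition sweedler W (f : M -> M -> W) (x : M) : W := tlift f (comul M x).

Lemma sweedler_linear W (f : M -> M -> W) : bilin f -> linear (sweedler f).
Proof.
by move=> bf; apply: linear_comp (tlift_linear bf) => k x y; rewrite linearP.
Qed.

(** Coassociativity, tested on a trilinear map instead of stated between two
    bracketings of the third tensor power. *)
Lemma sweedlerA W (f : M -> M -> M -> W) x : trilin f ->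
  sweedler (fun y z => sweedler (f y) z) x =
  sweedler (fun y z => sweedler (fun y1 y2 => f y1 y2 z) y) x.
Proof.
move=> tf.
pose g (t : tensor M M) z := tlift (fun y1 y2 => f y1 y2 z) t.
have bf z : bilin (fun y1 y2 => f y1 y2 z).
  by split=> [u|u]; [exact: tf.1 | exact: (tf.2 u).1].
have bg : bilin g.
  split=> [z|t]; first exact: tlift_linear.
  by apply: tlift_param => y1 y2; exact: (tf.2 y1).2.
have lg := tlift_linear bg; have ta := @tassocl_trilin K M M M.
have := congr1 (tlift g) (comulA x).
rewrite /tmap (tlift_comp _ _ (linear_comp (tlift3_linear ta) lg)).
rewrite (tlift_comp _ _ lg) => e; rewrite /sweedler.
transitivity
  (tlift (fun (y : M) z => tlift g ((comul M y : tensor M M) \ox z)) (comul M x)).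
  rewrite -e; apply: eq_tlift => y z.
  rewrite /tassocl /tlift3 (tliftE (tlift3_bilin ta)) (tlift_comp _ _ lg).
  by apply: eq_tlift => u w; rewrite (tliftE bg) /g (tliftE (bf w)).
by apply: eq_tlift => y z; rewrite (tliftE bg).
Qed.

Lemma comul3E W (f : M -> M -> M -> W) x : trilin f ->
  tlift3 f (comul3 x) = sweedler (fun y z => sweedler (f y) z) x.
Proof.
move=> tf; rewrite /comul3 /tmap (tlift_comp _ _ (tlift3_linear tf)).
by apply: eq_tlift => y z; rewrite /tlift3 (tliftE (tlift3_bilin tf)).
Qed.

Variable v : {linear tensor M M -> K^o}.

(** The sum v(al (x) x^1) x^2. With it a threefold Sweedler sum weighted by the
    form becomes a twofold one, as in [form_sumE]. *)
Definition contract (al x : M) : M :=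
  sweedler (fun y z => (v (al \ox y) : K) *: z) x.

Lemma form_linear (al : M) : linear (fun x : M => v (al \ox x) : K^o).
Proof. by apply: linear_comp (linearP v) => k x y; rewrite (pureP M M).2. Qed.

Lemma form_scale_bilin W (al : M) :
  bilin (fun (y : M) (w : W) => (v (al \ox y) : K) *: w).
Proof.
split=> [w|y] k x x'; first by rewrite form_linear scalerDl scalerA.
by rewrite scalerDr !scalerA mulrC.
Qed.

Lemma contract_linear al : linear (contract al).
Proof. exact/sweedler_linear/form_scale_bilin. Qed.

Lemma contract_sweedler W (f : M -> W) al x : linear f ->
  f (contract al x) = sweedler (fun y z => (v (al \ox y) : K) *: f z) x.
Proof.
move=> lf; rewrite /contract /sweedler (tlift_comp _ _ lf).
by apply: eq_tlift => y z; rewrite (linZ lf).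
Qed.

(** Contraction is a map of right comodules, by coassociativity. *)
Lemma sweedler_contract W (f : M -> M -> W) al x : bilin f ->
  sweedler f (contract al x) = sweedler (fun y z => f (contract al y) z) x.
Proof.
move=> bf; rewrite (contract_sweedler _ _ (sweedler_linear bf)).
transitivity (sweedler (fun y z => sweedler (fun z1 z2 =>
    (v (al \ox y) : K) *: f z1 z2) z) x).
  apply: eq_tlift => y z; rewrite /sweedler.
  exact: (tlift_comp _ _ ((form_scale_bilin W al).2 y)).
rewrite sweedlerA; last first.
  split=> [y z|y]; first exact: (form_scale_bilin _ al).1.
  by split=> [z|z]; apply: linear_comp ((form_scale_bilin _ al).2 _);
    [exact: bf.1 | exact: bf.2].
by apply: eq_tlift => y z; rewrite (contract_sweedler _ _ (bf.1 z)).
Qed.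

Lemma form_hatE al x :
  form_hat v (al \ox x) = sweedler (fun y z => y \ox contract al z) x.
Proof.
have tr (be : M) : trilin (fun b1 b2 b3 : M => (v (be \ox b2) : K) *: (b1 \ox b3)).
  split=> [b2 b3|b1].
    by apply: linear_comp ((form_scale_bilin _ be).2 _); exact: (pureP M M).1.
  split=> [b3|b2]; first exact: (form_scale_bilin _ be).1.
  by apply: linear_comp ((form_scale_bilin _ be).2 _); exact: (pureP M M).2.
rewrite /form_hat tliftE; last first.
  split=> [y|be].
    rewrite /tlift3; apply: tlift_param => b1 t; apply: tlift_param => b2 b3 k be be'.
    by rewrite (pureP M M).1 linearP scalerDl scalerA.
  apply: linear_comp (tlift3_linear (tr be)) => k y y'.
  rewrite /comul3 linearP; apply: tlift_linear.
  split=> [z|z]; first exact/pure_linear_l/linear_id.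
  by apply: pure_linear_r => l z1 z2; rewrite linearP.
rewrite comul3E //; apply: eq_tlift => y z.
by rewrite (contract_sweedler _ _ (pure_linear_r y (@linear_id _ _))).
Qed.

(** The sum v(al (x) x^2) f(x^1, x^3): the only way in which the form and the
    comultiplication enter the induced bracket. *)
Definition form_sum W (f : M -> M -> W) (al x : M) : W :=
  tlift f (form_hat v (al \ox x)).

Lemma form_sumE W (f : M -> M -> W) al x : bilin f ->
  form_sum f al x = sweedler (fun y z => f y (contract al z)) x.
Proof.
move=> bf; rewrite /form_sum form_hatE /sweedler (tlift_comp _ _ (tlift_linear bf)).
by apply: eq_tlift => y z; rewrite (tliftE bf).
Qed.

Lemma form_sum_linear W (f : M -> M -> W) al : bilin f -> linear (form_sum f al).
Proof.
move=> bf k x y; rewrite !(form_sumE _ _ bf); apply: sweedler_linear.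
split=> [z|z]; first exact: bf.1.
exact: linear_comp (contract_linear al) (bf.2 z).
Qed.

Lemma form_sum_param W (X : lmodType K) (f : X -> M -> M -> W) al x :
  (forall y z, linear (fun w => f w y z)) -> linear (fun w => form_sum (f w) al x).
Proof. exact: tlift_param. Qed.

Lemma form_sum_comp W (X : lmodType K) (f : M -> M -> W) (g : W -> X) al x : linear g ->
  g (form_sum f al x) = form_sum (fun y z => g (f y z)) al x.
Proof. exact: tlift_comp. Qed.

Lemma eq_form_sum W (f g : M -> M -> W) al x :
  (forall y z, f y z = g y z) -> form_sum f al x = form_sum g al x.
Proof. exact: eq_tlift. Qed.

(** Both sides are v(al (x) x^2) v(be (x) x^4) f(x^1, x^3, x^5). After the outer
    sums are written with [contract], the inner one on the right is moved
    inside by [sweedler_contract], and the two sides are bracketings of one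
    threefold Sweedler sum. *)
Lemma form_sumA W (f : M -> M -> M -> W) al be x : trilin f ->
  form_sum (fun y z => form_sum (fun y1 y2 => f y1 y2 z) al y) be x =
  form_sum (fun y z => form_sum (f y) be z) al x.
Proof.
move=> tf; have bf z : bilin (fun y1 y2 => f y1 y2 z).
  by split=> [u|u]; [exact: tf.1 | exact: (tf.2 u).1].
rewrite form_sumE; last first.
  split=> [z|y]; first exact: form_sum_linear.
  by apply: form_sum_param => y1 y2; exact: (tf.2 y1).2.
rewrite form_sumE; last first.
  split=> [z|y]; first by apply: form_sum_param => z1 z2; exact: tf.1.
  exact: form_sum_linear (tf.2 y).
have -> : sweedler (fun y z => form_sum (fun y1 y2 => f y1 y2 (contract be z)) al y) x =
  sweedler (fun y z =>
    sweedler (fun y1 y2 => f y1 (contract al y2) (contract be z)) y) x.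
  by apply: eq_tlift => y z; rewrite form_sumE.
have -> : sweedler (fun y z => form_sum (f y) be (contract al z)) x =
  sweedler (fun y z =>
    sweedler (fun z1 z2 => f y (contract al z1) (contract be z2)) z) x.
  apply: eq_tlift => y z; rewrite (form_sumE _ _ (tf.2 y)) sweedler_contract //.
  split=> [u|u]; first exact: (tf.2 y).1.
  exact: linear_comp (contract_linear be) ((tf.2 y).2 u).
rewrite sweedlerA //; split=> [y z|y]; first exact: tf.1.
split=> [z|z].
  exact: linear_comp (contract_linear al) ((tf.2 y).1 _).
exact: linear_comp (contract_linear be) ((tf.2 y).2 _).
Qed.

Lemma form_sumC W (f : M -> M -> W) al x : bilin f -> cyclic_form v ->
  form_sum f x al = form_sum (fun y z => f z y) al x.
Proof.
move=> bf cv; have := cv (al \ox x).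
have bfl : bilin (fun (y z : M) => z \ox y).
  by split=> [z|z]; [exact/pure_linear_r/linear_id | exact/pure_linear_l/linear_id].
rewrite /tflip (tliftE bfl) /form_sum => ->.
rewrite (tlift_comp _ _ (tlift_linear bf)).
by apply: eq_tlift => y z; rewrite (tliftE bf).
Qed.

End Sweedler.

(** * The Jacobi form of a biderivation *)

Section Biderivation.
Context (K : comPzRingType) (n : int) (B : gradedAlgebra K).
Variable br : {linear tensor B B -> B}.
Hypothesis bd : biderivation n br.
Implicit Types (p q r : int) (a b c : B).

Local Notation "{ a , b }" := (br (a \ox b)).

Lemma br_linear_r a : linear (fun b => {a, b}).
Proof. by move=> k b c; rewrite (pureP B B).2 linearP. Qed.

(** The Jacobi identity as a derivation rule: the form that passes to products
    in the last argument. *)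
Definition leibniz p q a b c : Prop :=
  {a, {b, c}} = {{a, b}, c} + ksign ((p + n) * (q + n)) *: {b, {a, c}}.

(** Skew symmetry turns the outer brackets with c so that c is rightmost in all
    three terms; what remains is the overall sign of the first term. *)
Lemma jacobi_leibniz p q r a b c : gr B p a -> gr B q b -> gr B r c ->
  jacobi n br p q r a b c = 0 <-> leibniz p q a b c.
Proof.
move=> pa qb rc; have rl := br_linear_r.
have -> : jacobi n br p q r a b c = ksign ((p + n) * (r + n)) *:
    ({a, {b, c}} - ({{a, b}, c} + ksign ((p + n) * (q + n)) *: {b, {a, c}})).
  rewrite /jacobi (bd_skew bd rc pa) (bd_skew bd rc (bd_deg bd pa qb)).
  rewrite (linN (rl _)) (linZ (rl _)) scalerBr scalerDr opprD addrA.
  rewrite !scalerN !scalerA -!ksignD addrAC.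
  congr (_ - _ *: _ - _ *: _); parity.
split=> [h|->]; last by rewrite subrr scaler0.
apply/eqP; rewrite -subr_eq0; apply/eqP.
by rewrite -[LHS]scale1r -(@ksign_sq K ((p + n) * (r + n))) -scalerA h scaler0.
Qed.

(** The commutator of two graded derivations is a graded derivation: in the
    expansion the mixed terms {b, c}{a, d} and {a, c}{b, d} occur on both sides
    with equal signs. *)
Lemma leibnizM p q r s a b c d :
  gr B p a -> gr B q b -> gr B r c -> gr B s d ->
  leibniz p q a b c -> leibniz p q a b d -> leibniz p q a b (c ** d).
Proof.
rewrite /leibniz => pa qb rc sd hc hd; have rl := br_linear_r.
have [ml mr] := gmul_bilin B; have dg := @bd_deg _ _ _ _ bd.
rewrite (bd_mulr bd qb rc sd) (bd_mulr bd pa rc sd).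
rewrite (bd_mulr bd (dg _ _ _ _ pa qb) rc sd).
rewrite !(linD (rl _)) !(linZ (rl _)).
rewrite (bd_mulr bd pa (dg _ _ _ _ qb rc) sd) (bd_mulr bd pa rc (dg _ _ _ _ qb sd)).
rewrite (bd_mulr bd qb (dg _ _ _ _ pa rc) sd) (bd_mulr bd qb rc (dg _ _ _ _ pa sd)).
rewrite hc hd !(linD (ml _)) !(linD (mr _)) !(linZ (ml _)) !(linZ (mr _)).
rewrite !scalerDr !scalerA -!ksignD.
rewrite [RHS](AC (2*(2*2)) ((1*3*5)*(4*(2*6)))) /=.
congr (_ + _ + _ *: _ + (_ *: _ + (_ *: _ + _ *: _))); parity.
Qed.

Lemma leibniz_linear_r p q a b k c d :
  leibniz p q a b c -> leibniz p q a b d -> leibniz p q a b (k *: c + d).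
Proof.
move=> hc hd; rewrite /leibniz !br_linear_r hc hd.
by rewrite !scalerDr !scalerA [_ * k]mulrC addrACA.
Qed.

Lemma jacobi_rot p q r a b c : jacobi n br p q r a b c = jacobi n br q r p b c a.
Proof. by rewrite /jacobi -addrA addrC. Qed.

End Biderivation.

(** * Reduction of the Jacobi identity to generators *)

Section RepJacobi.
Context (K : comPzRingType) (n : int) (A : gradedAlgebra K) (M : coalgebra K).
Variable br : {linear tensor (repAlg A M) (repAlg A M) -> repAlg A M}.
Hypothesis bd : biderivation n br.

(** Induction along the generation of the grading: sums by linearity, products
    by [leibnizM]. *)
Lemma jacobi_rep_r p q (x y : repAlg A M) : gr _ p x -> gr _ q y ->
  (forall r c ga, gr A r c -> jacobi n br p q r x y (rep c ga) = 0) ->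
  forall r z, gr (repAlg A M) r z -> jacobi n br p q r x y z = 0.
Proof.
move=> px qy h r z rz; apply/(jacobi_leibniz bd px qy rz).
elim: rz => {r z} [r c ga rc|r|r k z w _ hz _ hw|r s z w rz hz sw hw].
- by apply/(jacobi_leibniz bd px qy (rgr_gen ga rc : gr (repAlg A M) r _)); exact: h.
- by rewrite /leibniz !(lin0 (br_linear_r br _)) scaler0 addr0.
- exact: leibniz_linear_r.
exact: (leibnizM bd px qy rz sw).
Qed.

(** [jacobi_rep_r] extends the last argument only, so each argument is rotated
    there in turn. *)
Lemma jacobi_rep :
  (forall p q r a b c al be ga, gr A p a -> gr A q b -> gr A r c ->
    jacobi n br p q r (rep a al) (rep b be) (rep c ga) = 0) ->
  forall p q r x y z, gr (repAlg A M) p x -> gr (repAlg A M) q y ->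
    gr (repAlg A M) r z -> jacobi n br p q r x y z = 0.
Proof.
move=> h p q r x y z px qy rz; have g p' a al :
  gr A p' a -> gr (repAlg A M) p' (rep a al) by exact: rgr_gen.
apply: (jacobi_rep_r px qy _ rz) => {r z rz} r c ga rc.
rewrite -jacobi_rot; apply: (jacobi_rep_r (g _ _ ga rc) px _ qy) => {q y qy} q b be qb.
rewrite -jacobi_rot; apply: (jacobi_rep_r (g _ _ be qb) (g _ _ ga rc) _ px).
by move=> {p x px} p a al pa; rewrite -jacobi_rot; exact: h.
Qed.

End RepJacobi.

(** * Products of two and three generators *)

Lemma gmul_linear_l (K : comPzRingType) (A : gradedAlgebra K) (W : lmodType K)
  (f : W -> A) b : linear f -> linear (fun w => f w ** b).
Proof. by move=> lf k x y; rewrite lf (gmul_bilin A).1. Qed.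

Lemma gmul_linear_r (K : comPzRingType) (A : gradedAlgebra K) (W : lmodType K)
  (f : W -> A) a : linear f -> linear (fun w => a ** f w).
Proof. by move=> lf k x y; rewrite lf (gmul_bilin A).2. Qed.

Section Words.
Context (K : comPzRingType) (A : gradedAlgebra K) (M : coalgebra K).
Local Notation B := (repAlg A M).
Implicit Types (a b c : A) (x y z : M).

Lemma rep_linear_l x : linear (fun a => rep a x : B).
Proof. exact: (rgen_bilin A M).1. Qed.

Lemma rep_linear_r a : linear (fun x => rep a x : B).
Proof. exact: (rgen_bilin A M).2. Qed.

Definition rep_word2 x y : tensor A A -> B :=
  tlift (fun a b => rep a x ** rep b y).

Definition rep_word3 x y z : tensor A (tensor A A) -> B :=
  tlift3 (fun a b c => rep a x ** (rep b y ** rep c z)).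

Lemma word2_bilin x y : bilin (fun a b => rep a x ** rep b y : B).
Proof.
split=> [b|a]; first exact/gmul_linear_l/rep_linear_l.
exact/gmul_linear_r/rep_linear_l.
Qed.

Lemma word3_trilin x y z :
  trilin (fun a b c => rep a x ** (rep b y ** rep c z) : B).
Proof.
split=> [b c|a]; first exact/gmul_linear_l/rep_linear_l.
by split=> [c|b]; apply: gmul_linear_r;
  [exact: (word2_bilin y z).1 | exact: (word2_bilin y z).2].
Qed.

Lemma rep_word2_linear x y : linear (rep_word2 x y).
Proof. exact/tlift_linear/word2_bilin. Qed.

Lemma rep_word2E x y a b : rep_word2 x y (a \ox b) = rep a x ** rep b y.
Proof. exact/tliftE/word2_bilin. Qed.

Lemma rep_word3_linear x y z : linear (rep_word3 x y z).
Proof. exact/tlift3_linear/word3_trilin. Qed.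

Lemma rep_word3E x y z a b c :
  rep_word3 x y z (a \ox (b \ox c)) = rep a x ** (rep b y ** rep c z).
Proof. exact/tlift3E/word3_trilin. Qed.

Lemma rep_word2_bilin t : bilin (fun x y => rep_word2 x y t).
Proof.
split=> [y|x]; apply: tlift_param => a b.
  exact/gmul_linear_l/rep_linear_r.
exact/gmul_linear_r/rep_linear_r.
Qed.

Lemma rep_word3_trilin t : trilin (fun x y z => rep_word3 x y z t).
Proof.
split=> [y z|x].
  apply: tlift_param => a t'; apply: tlift_param => b c.
  exact/gmul_linear_l/rep_linear_r.
split=> [z|y]; apply: tlift_param => a t'; apply: tlift_param => b c.
  exact/gmul_linear_r/gmul_linear_l/rep_linear_r.
exact/gmul_linear_r/gmul_linear_r/rep_linear_r.
Qed.

Lemma rep_word3_pure x y z a t :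
  rep_word3 x y z (a \ox t) = rep a x ** rep_word2 y z t.
Proof.
apply: (tensor_ext (f := fun t => rep_word3 x y z (a \ox t))
  (g := fun t => rep a x ** rep_word2 y z t)) => [||b c].
- exact: linear_comp (pure_linear_r _ (@linear_id _ _)) (rep_word3_linear x y z).
- exact/gmul_linear_r/rep_word2_linear.
by rewrite rep_word3E rep_word2E.
Qed.

Lemma rep_word3_tassocr x y z t c :
  rep_word3 x y z (tassocr (t \ox c)) = rep_word2 x y t ** rep c z.
Proof.
apply: (tensor_ext (f := fun t => rep_word3 x y z (tassocr (t \ox c)))
  (g := fun t => rep_word2 x y t ** rep c z)) => [||a b].
- exact: linear_comp (@tassocr_pure_linear _ _ _ _ c) (rep_word3_linear x y z).
- exact/gmul_linear_l/rep_word2_linear.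
by rewrite tassocrE rep_word3E rep_word2E gmulA.
Qed.

Lemma repC p q a b x y : gr A p a -> gr A q b ->
  rep a x ** rep b y = ksign (p * q) *: (rep b y ** rep a x : B).
Proof. exact: rgenC. Qed.

(** The sign of P_312 is the Koszul sign of moving the third generator to the
    front of the product. *)
Lemma rep_word3_P312 x y z t :
  rep_word3 x y z (P312 0 t) = rep_word3 y z x t.
Proof.
have lP := @P312_linear K A 0; have lw := rep_word3_linear.
apply: (hom_tensor3_ext (linear_comp lP (lw x y z)) (lw y z x)) => p q r a b c pa qb rc.
rewrite (P312E _ pa qb rc) (linZ (lw x y z)) !rep_word3E.
have [ml mr] := gmul_bilin B.
rewrite gmulA (repC _ _ rc pa) (linZ (ml _)) -gmulA (repC _ _ rc qb) (linZ (mr _)).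
by rewrite !scalerA !addr0 ksignD -mulrA mulrACA !ksign_sq mulr1 scale1r.
Qed.

End Words.

(** * The Jacobi identity on generators *)

Section InducedJacobi.
Context (K : comPzRingType) (n : int) (A : gradedAlgebra K) (M : coalgebra K).
Variables (db : {linear tensor A A -> tensor A A}) (v : {linear tensor M M -> K^o}).
Variable br : {linear tensor (repAlg A M) (repAlg A M) -> repAlg A M}.
Local Notation B := (repAlg A M).
Implicit Types (a b c : A) (al be ga : M) (p q r : int).

Lemma rep_bracketE a b al be :
  rep_bracket v db a b al be =
  form_sum v (fun y z => rep_word2 y z (db (a \ox b))) al be.
Proof.
have wb := rep_word2_bilin M (db (a \ox b)).
have [sl sr] := form_scale_bilin v B al.
rewrite /rep_bracket -/(rep_word2 _ _ _) comul3E; last first.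
  split=> [y z|x]; first exact: linear_comp (wb.1 z) (sr y).
  by split=> [z|y]; [exact: sl | exact: linear_comp (wb.2 x) (sr y)].
rewrite form_sumE //; apply: eq_tlift => y z.
by rewrite (contract_sweedler _ _ _ (wb.2 y)).
Qed.

(** The value T(al, be, ga; t), where al is paired with the second and be with
    the fourth of the five components of ga. *)
Definition rep_triple al be ga (t : tensor A (tensor A A)) : B :=
  form_sum v (fun y z => form_sum v (fun y1 y2 => rep_word3 y1 y2 z t) al y) be ga.

Lemma rep_triple_linear al be ga : linear (rep_triple al be ga).
Proof.
apply: form_sum_param => y z; apply: form_sum_param => y1 y2.
exact: rep_word3_linear.
Qed.

Lemma rep_triple_assocr al be ga t c :
  rep_triple al be ga (tassocr (t \ox c)) =
  form_sum v (fun y z =>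
    form_sum v (fun y1 y2 => rep_word2 y1 y2 t) al y ** rep c z) be ga.
Proof.
apply: eq_form_sum => y z.
rewrite (form_sum_comp _ _ _ _ ((gmul_bilin B).1 (rep c z))).
by apply: eq_form_sum => y1 y2; rewrite rep_word3_tassocr.
Qed.

(** Coassociativity regroups the nested sums so that the contraction with al
    falls on the last two factors. *)
Lemma rep_triple_pure al be ga a t :
  rep_triple be al ga (a \ox t) =
  form_sum v (fun y z =>
    rep a y ** form_sum v (fun z1 z2 => rep_word2 z1 z2 t) al z) be ga.
Proof.
rewrite /rep_triple form_sumA; last exact: rep_word3_trilin.
apply: eq_form_sum => y z.
rewrite (form_sum_comp _ _ _ _ ((gmul_bilin B).2 (rep a y))).
by apply: eq_form_sum => z1 z2; rewrite rep_word3_pure.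
Qed.

Hypothesis cv : cyclic_form v.

(** [rep_word3_P312] rotates the three factors, [form_sumA] makes the sum over
    al the outer one, and [form_sumC] exchanges al and ga there. *)
Lemma rep_triple_rot al be ga t :
  rep_triple be ga al t = rep_triple al be ga (P312 0 t).
Proof.
have wt := rep_word3_trilin M t.
have -> : rep_triple al be ga (P312 0 t) = form_sum v (fun y z =>
    form_sum v (fun y1 y2 => rep_word3 y2 z y1 t) al y) be ga.
  by apply: eq_form_sum => y z; apply: eq_form_sum => y1 y2; rewrite rep_word3_P312.
rewrite (@form_sumA _ _ _ _ (fun y1 y2 z => rep_word3 y2 z y1 t)); last first.
  split=> [y z|x]; first exact: (wt.2 _).2.
  by split=> [z|y]; [exact: wt.1 | exact: (wt.2 _).1].
rewrite /rep_triple form_sumC //.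
split=> [z|y].
  by apply: form_sum_linear; split=> [y2|y1]; [exact: wt.1 | exact: (wt.2 _).1].
by apply: form_sum_param => y1 y2; exact: (wt.2 y1).2.
Qed.

(** {{a, t'}} (x) t'', the outer of the two double brackets in the tribracket. *)
Definition double_head a (t : tensor A A) : tensor A (tensor A A) :=
  tassocr (tmap db id (tassocl (a \ox t))).

(** The composite X, whose rotations add up to the tribracket. *)
Definition double_step (t : tensor A (tensor A A)) : tensor A (tensor A A) :=
  tassocr (tmap db id (tassocl (tmap id db t))).

Lemma double_right_bilin :
  bilin (fun (t : tensor A A) c => (db t : tensor A A) \ox c).
Proof.
split=> [c|t]; first by apply: pure_linear_l => k x y; rewrite linearP.
exact/pure_linear_r/linear_id.
Qed.

Lemma double_left_bilin : bilin (fun a (t : tensor A A) => a \ox (db t : tensor A A)).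
Proof.
split=> [c|t]; first exact/pure_linear_l/linear_id.
by apply: pure_linear_r => k x y; rewrite linearP.
Qed.

Lemma double_headE a b c : double_head a (b \ox c) = tassocr (db (a \ox b) \ox c).
Proof.
rewrite /double_head [tassocl _](tlift3E _ _ _ (@tassocl_trilin _ _ _ _)).
by congr tassocr; exact: (tliftE double_right_bilin).
Qed.

Lemma double_head_linear a : linear (double_head a).
Proof.
have la := pure_linear_r (W := tensor A A) a (@linear_id _ _).
have ll := linear_comp la (tlift3_linear (@tassocl_trilin K A A A)).
have lr := linear_comp (tlift_linear double_right_bilin) (@tassocr_linear K A A A).
exact: linear_comp ll lr.
Qed.

Lemma double_step_linear : linear double_step.
Proof.
have ll := linear_comp (tlift_linear double_left_bilin)
  (tlift3_linear (@tassocl_trilin K A A A)).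
have lr := linear_comp (tlift_linear double_right_bilin) (@tassocr_linear K A A A).
exact: linear_comp ll lr.
Qed.

Lemma double_stepE a t : double_step (a \ox t) = double_head a (db t).
Proof. by rewrite /double_step [tmap id db _](tliftE double_left_bilin). Qed.

Hypothesis dbr : double_bracket n db.
Hypothesis ibr : induced_biderivation v n db br.

(** Homogeneity of t makes the sign of the rotation the same for all its
    terms. *)
Lemma P312_assocr m r (t : tensor A A) c : tens_gr m t -> gr A r c ->
  P312 0 (tassocr (t \ox c)) = ksign (r * m) *: (c \ox t).
Proof.
case=> s [hs ->] rc.
have lP := linear_comp (@tassocr_pure_linear K A A A c) (@P312_linear K A 0).
rewrite (lin_sum lP) (lin_sum ((pureP A _).2 c)) scaler_sumr.
rewrite big_seq [RHS]big_seq; apply: eq_bigr => w /hs [i [j [wi wj <-]]].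
by rewrite tassocrE (P312E _ wi wj rc) !addr0 mulrDr.
Qed.

Lemma form_word2_linear al be :
  linear (fun t => form_sum v (fun y z => rep_word2 y z t : B) al be).
Proof. by apply: form_sum_param => y z; exact: rep_word2_linear. Qed.

(** For t homogeneous and decomposable, the derivation rule splits the bracket
    into two sums. In the second one, the factors of t are put in the opposite
    order and [rep_triple_rot] restores the order in the product; the sign of
    the derivation rule and that of the rotation combine to that of P_21. *)
Lemma br_form_word2 p a al be ga t : gr A p a ->
  br (rep a al \ox form_sum v (fun y z => rep_word2 y z t) be ga) =
  rep_triple al be ga (double_head a t) +
  rep_triple al ga be (double_head a (P21 0 t)).
Proof.
move=> pa; have [bd brE] := ibr; have lt := rep_triple_linear.
have lh := double_head_linear a; have rl := br_linear_r br (rep a al).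
have rg q b y : gr A q b -> gr B q (rep b y) by exact: rgr_gen.
apply: (hom_tensor_ext (linear_comp (form_word2_linear be ga) rl)
  (g := fun t => rep_triple al be ga (double_head a t) +
    rep_triple al ga be (double_head a (P21 0 t)))).
  by move=> k x y; rewrite lh lt P21_linear lh lt scalerDr addrACA.
move=> i j x y ix jy; rewrite (P21E _ ix jy) !addr0 (linZ lh) (linZ (lt _ _ _)).
rewrite !double_headE (rep_triple_rot be al ga).
rewrite (P312_assocr (db_deg dbr pa jy) ix) (linZ (lt _ _ _)) scalerA.
rewrite rep_triple_assocr rep_triple_pure.
rewrite (form_sum_comp _ _ _ _ rl) /form_sum /tlift scaler_sumr -big_split /=.
apply: eq_bigr => w _; rewrite rep_word2E.
rewrite (bd_mulr bd (rg _ _ al pa) (rg _ _ w.1 ix) (rg _ _ w.2 jy)).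
rewrite !brE !rep_bracketE -ksignD; congr (_ + _ *: _); parity.
Qed.

(** [br_form_word2] at t = {{b, c}}; skew symmetry of the double bracket
    identifies P_21 {{b, c}} with {{c, b}} up to sign. *)
Lemma nested_bracket p q r a b c al be ga :
  gr A p a -> gr A q b -> gr A r c ->
  br (rep a al \ox br (rep b be \ox rep c ga)) =
  rep_triple al be ga (double_step (a \ox (b \ox c))) -
  ksign ((q + n) * (r + n)) *: rep_triple al ga be (double_step (a \ox (c \ox b))).
Proof.
move=> pa qb rc; have [_ brE] := ibr; have lt := rep_triple_linear.
have lh := double_head_linear a.
rewrite brE rep_bracketE (br_form_word2 _ _ _ _ pa) !double_stepE.
rewrite -[P21 0 _]opprK -(db_skew dbr) (P21E _ qb rc) linearZ.
by rewrite (linN lh) (linZ lh) (linN (lt _ _ _)) (linZ (lt _ _ _)).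
Qed.

Hypothesis tri0 : forall x, tribracket n db x = 0.

(** Applying T(al, be, ga; -) to the tribracket of a, b, c and using
    [rep_triple_rot] to absorb the powers of P_312. *)
Lemma cyclic_triple p q r a b c al be ga :
  gr A p a -> gr A q b -> gr A r c ->
  ksign ((p + n) * (r + n)) *: rep_triple al be ga (double_step (a \ox (b \ox c))) +
  ksign ((q + n) * (p + n)) *: rep_triple be ga al (double_step (b \ox (c \ox a))) +
  ksign ((r + n) * (q + n)) *: rep_triple ga al be (double_step (c \ox (a \ox b))) = 0.
Proof.
move=> pa qb rc.
have := tri0 (a \ox (b \ox c)).
rewrite /tribracket !big_ord_recl big_ord0 addr0 /= -!/(double_step _).
rewrite (P231E _ pa qb rc) (linZ (@P231_linear _ _ _)) (P231E _ qb rc pa).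
have lP := @P312_linear K A 0; have lt := @rep_triple_linear al be ga.
rewrite !(linZ double_step_linear) !(linZ lP).
move/(congr1 (fun t => ksign ((p + n) * (r + n)) *: rep_triple al be ga t)).
rewrite (lin0 lt) scaler0 => e; rewrite -[RHS]e !(linD lt) !(linZ lt).
rewrite (rep_triple_rot be ga al) !(rep_triple_rot al be ga) !scalerDr !scalerA.
rewrite -!ksignD addrA; congr (_ + _ *: _ + _ *: _); parity.
Qed.

(** By [nested_bracket] the Jacobi form is the difference of two sums as in
    [cyclic_triple]. *)
Lemma jacobi_rep_gen p q r a b c al be ga :
  gr A p a -> gr A q b -> gr A r c ->
  jacobi n br p q r (rep a al) (rep b be) (rep c ga) = 0.
Proof.
move=> pa qb rc; rewrite /jacobi.
rewrite (nested_bracket al be ga pa qb rc) (nested_bracket be ga al qb rc pa).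
rewrite (nested_bracket ga al be rc pa qb) !scalerBr !scalerA -!ksignD.
have e1 := cyclic_triple al be ga pa qb rc.
have := cyclic_triple al ga be pa rc qb.
(* This factor turns the signs for the arguments a, c, b into those produced
   by the second terms of the nested brackets. *)
move/(congr1 (fun x => ksign ((p + n) * (q + n) + (q + n) * (r + n) +
  (r + n) * (p + n)) *: x)).
rewrite scaler0 !scalerDr !scalerA -!ksignD => e2.
have := f_equal2 (fun x y : B => x - y) e1 e2; rewrite subrr => e.
rewrite -[RHS]e !opprD [RHS](AC (3*3) (1*4*(2*6)*(3*5))) /=.
congr (_ *: _ - _ *: _ + (_ *: _ - _ *: _) + (_ *: _ - _ *: _)); parity.
Qed.

End InducedJacobi.

Theorem theorem4p3 (K : comPzRingType) (n : int) (A : gradedAlgebra K)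
    (db : {linear tensor A A -> tensor A A})
    (M : coalgebra K) (v : {linear tensor M M -> GRing.regular K})
    (br : {linear tensor (repAlg A M) (repAlg A M) -> repAlg A M}) :
  double_gerstenhaber n db ->
  cyclic_form v ->
  induced_biderivation v n db br ->
  gerstenhaber n br.
Proof.
case=> dbr tri0 cv ibr; split; first exact: ibr.1.
apply: (jacobi_rep ibr.1) => p q r a b c al be ga.
exact: (jacobi_rep_gen cv dbr ibr tri0).
Qed.
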